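(* The set of finite TRSs $R$ that are weakly ground confluent, i.e. weakly confluent on every ground term, is $\Pi^0_2$-complete.
   Context: All TRSs are finite sets of rules over a finite signature; terms may contain variables, ground terms contain none. A TRS $R$ is weakly confluent on a term $t$ if for all terms $t_1,t_2$ with $t_1\leftarrow_R t\to_R t_2$ (single steps) there is a term $d$ with $t_1\to_R^* d\leftarrow_R^* t_2$. TRSs and terms are encoded as natural numbers by a standard effective Gödel numbering, and properties are identified with the corresponding sets of codes. $\Sigma^0_n,\Pi^0_n$ are the classes of the arithmetical hierarchy; a set $B$ is $\mathcal P$-complete if $B\in\mathcal P$ and every $A\in\mathcal P$ is many-one reducible to $B$ via a total computable function. *)

(* Defs.v *)
From Stdlib Require Import List Arith Relations.
Import ListNotations.

Inductive rf : Type :=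
| RZero : rf
| RSucc : rf
| RProj : nat -> rf
| RComp : rf -> list rf -> rf
| RPrec : rf -> rf -> rf
| RMu   : rf -> rf.

Inductive eval : rf -> list nat -> nat -> Prop :=
| ev_zero xs : eval RZero xs 0
| ev_succ x xs : eval RSucc (x :: xs) (S x)
| ev_proj i xs : i < length xs -> eval (RProj i) xs (nth i xs 0)
| ev_comp f gs xs ys y :
    evals gs xs ys -> eval f ys y -> eval (RComp f gs) xs y
| ev_prec0 g h xs y : eval g xs y -> eval (RPrec g h) (0 :: xs) y
| ev_precS g h n xs r y :
    eval (RPrec g h) (n :: xs) r -> eval h (n :: r :: xs) y ->
    eval (RPrec g h) (S n :: xs) y
| ev_mu f xs n :
    eval f (n :: xs) 0 ->
    (forall m, m < n -> exists k, eval f (m :: xs) (S k)) ->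
    eval (RMu f) xs n
with evals : list rf -> list nat -> list nat -> Prop :=
| evs_nil xs : evals [] xs []
| evs_cons g gs xs y ys : eval g xs y -> evals gs xs ys -> evals (g :: gs) xs (y :: ys).

Definition computable (f : nat -> nat) : Prop :=
  exists p : rf, forall n, eval p [n] (f n).

Definition decidable_rel (k : nat) (P : list nat -> Prop) : Prop :=
  exists p : rf, forall xs, length xs = k ->
    (P xs -> eval p xs 1) /\ (~ P xs -> eval p xs 0).

Fixpoint arith (n : nat) (sigma : bool) (k : nat) (P : list nat -> Prop) : Prop :=
  match n with
  | 0 => decidable_rel k P
  | S m =>
      if sigma then
        exists Q, arith m false (S k) Q /\
          forall xs, length xs = k -> (P xs <-> exists y, Q (y :: xs))
      else
        exists Q, arith m true (S k) Q /\
          forall xs, length xs = k -> (P xs <-> forall y, Q (y :: xs))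
  end.

Definition Sigma0 (n : nat) (A : nat -> Prop) : Prop :=
  arith n true 1 (fun xs => A (hd 0 xs)).
Definition Pi0 (n : nat) (A : nat -> Prop) : Prop :=
  arith n false 1 (fun xs => A (hd 0 xs)).

Definition m_reducible (A B : nat -> Prop) : Prop :=
  exists f, computable f /\ forall x, A x <-> B (f x).

Definition Pi0_complete (n : nat) (B : nat -> Prop) : Prop :=
  Pi0 n B /\ forall A, Pi0 n A -> m_reducible A B.

Inductive term : Type :=
| Var : nat -> term
| Fun : nat -> list term -> term.

(* A finite signature: a list of (symbol, arity) pairs. *)
Definition signature := list (nat * nat).

Fixpoint wf_term (sg : signature) (t : term) : Prop :=
  match t with
  | Var _ => True
  | Fun f ts =>
      In (f, length ts) sg /\
      (fix wfl (l : list term) : Prop :=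
         match l with [] => True | u :: l' => wf_term sg u /\ wfl l' end) ts
  end.

Fixpoint vars (t : term) : list nat :=
  match t with
  | Var x => [x]
  | Fun _ ts =>
      (fix vl (l : list term) : list nat :=
         match l with [] => [] | u :: l' => vars u ++ vl l' end) ts
  end.

Definition ground_term (sg : signature) (t : term) : Prop :=
  wf_term sg t /\ vars t = [].

Fixpoint subst (s : nat -> term) (t : term) : term :=
  match t with
  | Var x => s x
  | Fun f ts => Fun f (map (subst s) ts)
  end.

Record trs : Type := mkTRS { trs_sig : signature; trs_rules : list (term * term) }.

Definition wf_trs (R : trs) : Prop :=
  forall l r, In (l, r) (trs_rules R) ->
    wf_term (trs_sig R) l /\ wf_term (trs_sig R) r /\
    (forall x, l <> Var x) /\ incl (vars r) (vars l).

Inductive rstep (R : trs) : term -> term -> Prop :=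
| rs_root l r s : In (l, r) (trs_rules R) -> rstep R (subst s l) (subst s r)
| rs_ctx f ts1 t u ts2 :
    rstep R t u -> rstep R (Fun f (ts1 ++ t :: ts2)) (Fun f (ts1 ++ u :: ts2)).

Definition rsteps (R : trs) : term -> term -> Prop := clos_refl_trans term (rstep R).

Definition weakly_confluent_on (R : trs) (t : term) : Prop :=
  forall t1 t2, rstep R t t1 -> rstep R t t2 ->
    exists d, rsteps R t1 d /\ rsteps R t2 d.

Definition weakly_ground_confluent (R : trs) : Prop :=
  forall t, ground_term (trs_sig R) t -> weakly_confluent_on R t.

(* Cantor pairing (a bijection nat * nat -> nat). *)
Definition cpair (a b : nat) : nat := (a + b) * S (a + b) / 2 + b.

Fixpoint code_list (l : list nat) : nat :=
  match l with [] => 0 | x :: l' => S (cpair x (code_list l')) end.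

Fixpoint code_term (t : term) : nat :=
  match t with
  | Var x => cpair 0 x
  | Fun f ts => cpair 1 (cpair f (code_list (map code_term ts)))
  end.

Definition code_trs (R : trs) : nat :=
  cpair (code_list (map (fun p => cpair (fst p) (snd p)) (trs_sig R)))
        (code_list (map (fun p => cpair (code_term (fst p)) (code_term (snd p)))
                        (trs_rules R))).

Definition WGC_codes (n : nat) : Prop :=
  exists R, wf_trs R /\ code_trs R = n /\ weakly_ground_confluent R.

(* Main.v *)
(* Membership: rewriting and its side conditions form a Horn program over coded terms, and
   derivability in a Horn program is semidecidable.  Weak ground confluence says that every
   derivable peak is derivably joinable, which is a Pi-2 condition.

   Hardness: an abstract machine for recursive functions is a rewrite system in which every
   rule maps a state to a state and all other symbols are constructors.  It is orthogonal
   except that [start x] rewrites both to [done] and to [read x 0]; the latter checks that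
   [x] is a numeral, giving up with [done] otherwise, and then searches for a [y] with
   [Q y x n], ending in [done] if it finds one.  Runs are deterministic, so all peaks are
   joinable iff for every [x] the search succeeds. *)

From Stdlib Require Import List Arith Lia Bool Relations Classical Wellfounded.
Require Import Defs.
Import ListNotations.

(** * Computable functions *)

(** Terms are unsorted, so a ground term may carry garbage anywhere: [start] can be applied to a
    term that still reduces, or to one that can never become a numeral. Its peak must be joinable
    all the same, provided every search succeeds. Hence [read] rebuilds its first argument as a
    numeral in its second one and has a rule for every symbol other than zero and successor. Garbage
    elsewhere is harmless, because weak confluence concerns single-step peaks only, and these close
    whether or not the terms terminate.

    For the converse, the machine need only be shown to follow evaluations forwards. If no [y]
    exists, the tests of 0, 1, 2, ... form an infinite run, and determinism excludes that the same
    configuration also reaches [done]; no run ever has to be decoded.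

    For membership, a clause instance involves finitely many values, so a whole derivation fits into
    one number and checking it takes only bounded searches. *)

Definition comp (k : nat) (F : list nat -> nat) : Prop :=
  exists p, forall xs, length xs = k -> eval p xs (F xs).

Definition compb (k : nat) (P : list nat -> bool) : Prop :=
  comp k (fun xs => Nat.b2n (P xs)).

Lemma comp_ext k F G :
  comp k F -> (forall xs, length xs = k -> F xs = G xs) -> comp k G.
Proof. intros [p Hp] E. exists p. intros xs L. rewrite <- E; auto. Qed.

Lemma compb_ext k P Q :
  compb k P -> (forall xs, length xs = k -> P xs = Q xs) -> compb k Q.
Proof. intros H E. eapply comp_ext; [exact H|]. intros xs L. cbn. now rewrite E. Qed.

Lemma comp_nth k i : i < k -> comp k (fun xs => nth i xs 0).
Proof. intros H. exists (RProj i). intros xs L. constructor. lia. Qed.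

Lemma comp_succ k F : comp k F -> comp k (fun xs => S (F xs)).
Proof.
  intros [p Hp]. exists (RComp RSucc [p]). intros xs L.
  econstructor; [repeat constructor; auto | constructor].
Qed.

Lemma comp_const k c : comp k (fun _ => c).
Proof.
  induction c as [|c IH].
  - exists RZero. intros. constructor.
  - now apply (comp_succ k (fun _ => c)).
Qed.

Lemma comp_app3 h k F G H :
  comp 3 (fun xs => h (nth 0 xs 0) (nth 1 xs 0) (nth 2 xs 0)) ->
  comp k F -> comp k G -> comp k H -> comp k (fun xs => h (F xs) (G xs) (H xs)).
Proof.
  intros [q Hq] [p Hp] [r Hr] [s Hs]. exists (RComp q [p; r; s]). intros xs L.
  econstructor; [repeat constructor; auto | exact (Hq [F xs; G xs; H xs] eq_refl)].
Qed.

(** These projections pass an argument list on unchanged; the prefix [ys] serves the induction and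
    later allows leading arguments to be skipped. *)
Lemma evals_proj_seq (xs ys : list nat) :
  evals (map RProj (seq (length ys) (length xs))) (ys ++ xs) xs.
Proof.
  revert ys. induction xs as [|x xs IH]; intros ys; cbn; [constructor|].
  constructor.
  - replace x with (nth (length ys) (ys ++ x :: xs) 0) at 2.
    + constructor. rewrite length_app. cbn. lia.
    + rewrite app_nth2, Nat.sub_diag; auto.
  - specialize (IH (ys ++ [x])). rewrite length_app, <- app_assoc in IH.
    now rewrite Nat.add_1_r in IH.
Qed.

Lemma comp_rec k G H N :
  comp k G -> comp (S (S k)) H -> comp k N ->
  comp k (fun xs => nat_rect (fun _ => nat) (G xs) (fun m r => H (m :: r :: xs)) (N xs)).
Proof.
  intros [g Hg] [h Hh] [p Hp].
  exists (RComp (RPrec g h) (p :: map RProj (seq 0 k))). intros xs L. subst k.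
  econstructor.
  - constructor; [apply Hp; reflexivity|]. exact (evals_proj_seq xs []).
  - induction (N xs) as [|n IH]; cbn.
    + constructor. auto.
    + econstructor; [exact IH|]. apply Hh. reflexivity.
Qed.

Lemma comp_add k F G : comp k F -> comp k G -> comp k (fun xs => F xs + G xs).
Proof.
  intros HF HG. eapply comp_ext.
  - apply (comp_rec k G (fun ys => S (nth 1 ys 0)) F); auto.
    apply comp_succ, comp_nth. lia.
  - intros xs _. cbn. induction (F xs); cbn; lia.
Qed.

Lemma comp_pred k F : comp k F -> comp k (fun xs => pred (F xs)).
Proof.
  intros HF. eapply comp_ext.
  - apply (comp_rec k (fun _ => 0) (fun ys => nth 0 ys 0) F); auto.
    + apply comp_const.
    + apply comp_nth. lia.
  - intros xs _. cbn. now destruct (F xs).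
Qed.

Lemma comp_sub k F G : comp k F -> comp k G -> comp k (fun xs => F xs - G xs).
Proof.
  intros HF HG. eapply comp_ext.
  - apply (comp_rec k F (fun ys => pred (nth 1 ys 0)) G); auto.
    apply comp_pred, comp_nth. lia.
  - intros xs _. cbn. induction (G xs); cbn; lia.
Qed.

Lemma compb_const k b : compb k (fun _ => b).
Proof. exact (comp_const k (Nat.b2n b)). Qed.

Lemma comp_if k P F G :
  compb k P -> comp k F -> comp k G -> comp k (fun xs => if P xs then F xs else G xs).
Proof.
  intros HP HF HG. eapply comp_ext.
  - apply (comp_app3 (fun a b c => nat_rect (fun _ => nat) c (fun _ _ => b) a)
             k (fun xs => Nat.b2n (P xs)) F G); auto.
    (* The conditional is a recursion on the truth value. Its step function sees [m :: r ::
       [a; b; c]], hence index 3 for [b]. *)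
    apply (comp_rec 3 (fun xs => nth 2 xs 0) (fun ys => nth 3 ys 0) (fun xs => nth 0 xs 0));
      apply comp_nth; lia.
  - intros xs _. cbn. now destruct (P xs).
Qed.

Lemma compb_if k P Q R :
  compb k P -> compb k Q -> compb k R -> compb k (fun xs => if P xs then Q xs else R xs).
Proof.
  intros HP HQ HR. eapply comp_ext; [exact (comp_if k P _ _ HP HQ HR)|].
  intros xs _. cbn. now destruct (P xs).
Qed.

Lemma compb_and k P Q : compb k P -> compb k Q -> compb k (fun xs => P xs && Q xs).
Proof. intros HP HQ. exact (compb_if k P Q _ HP HQ (compb_const k false)). Qed.

Lemma compb_or k P Q : compb k P -> compb k Q -> compb k (fun xs => P xs || Q xs).
Proof. intros HP HQ. exact (compb_if k P _ Q HP (compb_const k true) HQ). Qed.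

Lemma compb_neg k P : compb k P -> compb k (fun xs => negb (P xs)).
Proof.
  intros HP. exact (compb_if k P _ _ HP (compb_const k false) (compb_const k true)).
Qed.

Lemma compb_le k F G : comp k F -> comp k G -> compb k (fun xs => F xs <=? G xs).
Proof.
  intros HF HG. eapply comp_ext.
  (* With truncated subtraction, [1 - (F - G)] is the truth value of [F <= G]. *)
  - exact (comp_sub k (fun _ => 1) _ (comp_const k 1) (comp_sub k F G HF HG)).
  - intros xs _. destruct (Nat.leb_spec (F xs) (G xs)); cbn [Nat.b2n]; lia.
Qed.

Lemma compb_eq k F G : comp k F -> comp k G -> compb k (fun xs => F xs =? G xs).
Proof.
  intros HF HG. eapply compb_ext.
  - apply compb_and; [exact (compb_le k F G HF HG) | exact (compb_le k G F HG HF)].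
  - intros xs _. cbn. apply eq_iff_eq_true.
    rewrite andb_true_iff, !Nat.leb_le, Nat.eqb_eq. lia.
Qed.


Lemma compb_exists k P N :
  compb (S k) P -> comp k N ->
  compb k (fun xs => existsb (fun i => P (i :: xs)) (seq 0 (N xs))).
Proof.
  intros [p Hp] HN. eapply comp_ext.
  - apply (comp_rec k (fun _ => 0)
             (fun ys => if 1 <=? nth 1 ys 0 then 1
                        else Nat.b2n (P (nth 0 ys 0 :: tl (tl ys)))) N); auto.
    + apply comp_const.
    + apply comp_if.
      * apply compb_le; [apply comp_const | apply comp_nth; lia].
      * apply comp_const.
      (* The counter and the original arguments are passed on; the accumulator at index 1 is
         skipped. *)
      * exists (RComp p (RProj 0 :: map RProj (seq 2 k))).
        intros [|a [|b xs]] L; try discriminate. cbn in *.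
        econstructor; [|apply Hp; cbn; lia].
        constructor; [apply (ev_proj 0); cbn; lia|].
        replace k with (length xs) by lia. exact (evals_proj_seq xs [a; b]).
  - intros xs _. cbn. induction (N xs) as [|n IH]; [reflexivity|].
    rewrite seq_S, existsb_app. cbn [nat_rect]. rewrite IH. cbn.
    destruct (existsb _ (seq 0 n)); cbn; [reflexivity|].
    now rewrite orb_false_r.
Qed.

Lemma compb_forall k P N :
  compb (S k) P -> comp k N ->
  compb k (fun xs => forallb (fun i => P (i :: xs)) (seq 0 (N xs))).
Proof.
  intros HP HN. eapply compb_ext.
  - apply compb_neg. apply (compb_exists k (fun ys => negb (P ys)) N); auto.
    now apply compb_neg.
  - intros xs _. cbn. induction (seq 0 (N xs)) as [|i l IH]; [reflexivity|].
    cbn. now rewrite negb_orb, negb_involutive, IH.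
Qed.

(** * Cantor pairing *)

(** Triangular numbers, in a recursive form that avoids showing division computable. *)
Fixpoint tri (n : nat) : nat := match n with 0 => 0 | S m => S m + tri m end.

Lemma tri_spec n : n * S n / 2 = tri n.
Proof.
  induction n as [|n IH]; [reflexivity|].
  change (tri (S n)) with (S n + tri n). rewrite <- IH.
  replace (S n * S (S n)) with (n * S n + S n * 2) by lia.
  rewrite Nat.div_add by lia. lia.
Qed.

Lemma cpair_tri a b : cpair a b = tri (a + b) + b.
Proof. unfold cpair. now rewrite tri_spec. Qed.

Lemma tri_mono m n : m <= n -> tri m <= tri n.
Proof. induction 1; cbn; lia. Qed.

(** The inverse of [tri], rounded down. From [n] to [S n] it grows by at most one, which makes it
    primitive recursive. *)
Fixpoint troot (n : nat) : nat :=
  match n with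
  | 0 => 0
  | S m => if tri (S (troot m)) <=? S m then S (troot m) else troot m
  end.

Lemma troot_spec n : tri (troot n) <= n < tri (S (troot n)).
Proof.
  induction n as [|n IH]; [cbn; lia|]. cbn [troot].
  destruct (Nat.leb_spec (tri (S (troot n))) (S n)); cbn [tri] in *; lia.
Qed.

Definition csnd n := n - tri (troot n).
Definition cfst n := troot n - csnd n.

Lemma troot_cpair a b : troot (cpair a b) = a + b.
Proof.
  rewrite cpair_tri. pose proof (troot_spec (tri (a + b) + b)) as H.
  set (r := troot _) in *.
  destruct (Nat.lt_trichotomy r (a + b)) as [L|[L|L]]; [|exact L|].
  - pose proof (tri_mono (S r) (a + b) L). lia.
  - pose proof (tri_mono (S (a + b)) r L) as L'. cbn [tri] in L'. lia.
Qed.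

Lemma csnd_cpair a b : csnd (cpair a b) = b.
Proof. unfold csnd. rewrite troot_cpair, cpair_tri. lia. Qed.

Lemma cfst_cpair a b : cfst (cpair a b) = a.
Proof. unfold cfst. rewrite troot_cpair, csnd_cpair. lia. Qed.

Lemma cpair_inj a b c d : cpair a b = cpair c d -> a = c /\ b = d.
Proof.
  intros E. pose proof (f_equal cfst E) as E1. pose proof (f_equal csnd E) as E2.
  rewrite !cfst_cpair in E1. rewrite !csnd_cpair in E2. auto.
Qed.

Lemma comp_tri k F : comp k F -> comp k (fun xs => tri (F xs)).
Proof.
  intros HF. eapply comp_ext.
  - apply (comp_rec k (fun _ => 0) (fun ys => S (nth 0 ys 0) + nth 1 ys 0) F); auto.
    + apply comp_const.
    + apply comp_add; [apply comp_succ|]; apply comp_nth; lia.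
  - intros xs _. cbn. induction (F xs); cbn; auto.
Qed.

Lemma comp_cpair k F G : comp k F -> comp k G -> comp k (fun xs => cpair (F xs) (G xs)).
Proof.
  intros HF HG. eapply comp_ext.
  - apply comp_add; [|exact HG]. apply comp_tri. exact (comp_add k F G HF HG).
  - intros xs _. cbn beta. now rewrite cpair_tri.
Qed.

Lemma comp_troot k F : comp k F -> comp k (fun xs => troot (F xs)).
Proof.
  intros HF. eapply comp_ext.
  - apply (comp_rec k (fun _ => 0)
      (fun ys => if tri (S (nth 1 ys 0)) <=? S (nth 0 ys 0) then S (nth 1 ys 0)
                 else nth 1 ys 0) F); auto.
    + apply comp_const.
    + apply comp_if; [apply compb_le; [apply comp_tri|]|..];
        try apply comp_succ; apply comp_nth; lia.
  - intros xs _. cbn beta. induction (F xs) as [|n IH]; [reflexivity|].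
    cbn [nat_rect]. rewrite IH. reflexivity.
Qed.

Lemma comp_csnd k F : comp k F -> comp k (fun xs => csnd (F xs)).
Proof. intros HF. apply (comp_sub k F); auto. now apply comp_tri, comp_troot. Qed.

Lemma comp_cfst k F : comp k F -> comp k (fun xs => cfst (F xs)).
Proof.
  intros HF. apply (comp_sub k (fun xs => troot (F xs))).
  - now apply comp_troot.
  - now apply comp_csnd.
Qed.

Opaque cpair.

(** * Horn clauses over natural numbers *)

Definition sdrop (s i : nat) : nat := nat_rect (fun _ => nat) s (fun _ r => csnd r) i.

(* Every number codes an infinite sequence by iterated pairing. *)
Definition snth (s i : nat) : nat := cfst (sdrop s i).

Fixpoint senc (l : list nat) : nat :=
  match l with [] => 0 | x :: l' => cpair x (senc l') end.

Lemma sdrop_csnd s i : sdrop s (S i) = sdrop (csnd s) i.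
Proof.
  induction i as [|i IH]; [reflexivity|].
  change (sdrop s (S (S i))) with (csnd (sdrop s (S i))). now rewrite IH.
Qed.

Lemma snth_senc l i : i < length l -> snth (senc l) i = nth i l 0.
Proof.
  revert i. induction l as [|x l IH]; intros i L; cbn in L; [lia|].
  destruct i as [|i]; unfold snth.
  - apply cfst_cpair.
  - rewrite sdrop_csnd. cbn [senc]. rewrite csnd_cpair. apply IH. lia.
Qed.

Lemma comp_snth k F G : comp k F -> comp k G -> comp k (fun xs => snth (F xs) (G xs)).
Proof.
  intros HF HG. apply comp_cfst.
  apply (comp_rec k F (fun ys => csnd (nth 1 ys 0)) G); auto.
  apply comp_csnd, comp_nth. lia.
Qed.

(** These constructors suffice for all codes: [PP] is pairing and [PS] the successor that marks a
    nonempty list. *)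
Inductive pat : Type :=
| PV : nat -> pat
| PC : nat -> pat
| PS : pat -> pat
| PP : pat -> pat -> pat.

Fixpoint pev (e : nat -> nat) (p : pat) : nat :=
  match p with
  | PV i => e i
  | PC c => c
  | PS p => S (pev e p)
  | PP p q => cpair (pev e p) (pev e q)
  end.

Fixpoint pbound (p : pat) : nat :=
  match p with
  | PV i => S i
  | PC _ => 0
  | PS p => pbound p
  | PP p q => max (pbound p) (pbound q)
  end.

Lemma pev_ext e e' p : (forall i, i < pbound p -> e i = e' i) -> pev e p = pev e' p.
Proof. induction p; cbn; intros H; auto. rewrite IHp1, IHp2; auto; intros; apply H; lia. Qed.

Lemma comp_pev k F p : comp k F -> comp k (fun xs => pev (snth (F xs)) p).
Proof.
  intros HF. induction p; cbn [pev].
  - apply comp_snth; [exact HF | apply comp_const].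
  - apply comp_const.
  - now apply comp_succ.
  - now apply comp_cpair.
Qed.

(* An atom [(tag, p)] stands for the predicate number [tag] applied to the value of [p]. *)
Definition atom : Type := nat * pat.
Definition clause : Type := atom * list atom.

Inductive derives (cls : list clause) : nat -> nat -> Prop :=
| derives_intro h b e :
    In (h, b) cls ->
    (forall a, In a b -> derives cls (fst a) (pev e (snd a))) ->
    derives cls (fst h) (pev e (snd h)).

Definition aev (e : nat -> nat) (a : atom) : nat := cpair (fst a) (pev e (snd a)).

(** A derivation uses arbitrary environments, a certificate only coded ones. Cutting an environment
    off at this bound changes no atom of the clause. *)
Definition clause_bound (c : clause) : nat :=
  list_max (map (fun a => pbound (snd a)) (fst c :: snd c)).

Definition restrict_env (e : nat -> nat) (n : nat) : nat := senc (map e (seq 0 n)).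

Lemma pev_restrict e n p : pbound p <= n -> pev (snth (restrict_env e n)) p = pev e p.
Proof.
  intros H. apply pev_ext. intros i L. unfold restrict_env.
  rewrite snth_senc by (rewrite length_map, length_seq; lia).
  rewrite (nth_indep _ 0 (e 0)) by (rewrite length_map, length_seq; lia).
  rewrite map_nth, seq_nth; auto. lia.
Qed.

Lemma clause_bound_spec h b a :
  a = h \/ In a b -> pbound (snd a) <= clause_bound (h, b).
Proof.
  intros H. unfold clause_bound.
  pose proof (proj1 (list_max_le (map (fun a => pbound (snd a)) (fst (h, b) :: snd (h, b))) _) (le_n _)) as F.
  rewrite Forall_forall in F. apply F. apply (in_map (fun a => pbound (snd a))).
  destruct H as [->|H]; cbn; auto.
Qed.

(* A certificate is a pair of a length and a sequence of pairs of an environment and an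
   atom; each atom is the head of a clause instance whose body atoms occur earlier. *)
Definition justified (cls : list clause) (before : nat -> bool) (x : nat) : bool :=
  existsb (fun c : clause =>
    (csnd x =? aev (snth (cfst x)) (fst c)) &&
    forallb (fun a => before (aev (snth (cfst x)) a)) (snd c)) cls.

Definition occurs_before (s i v : nat) : bool :=
  existsb (fun j => csnd (snth s j) =? v) (seq 0 i).

Definition check (cls : list clause) (c tag v : nat) : bool :=
  forallb (fun i => justified cls (occurs_before (csnd c) i) (snth (csnd c) i))
    (seq 0 (cfst c)) &&
  occurs_before (csnd c) (cfst c) (cpair tag v).

Lemma compb_occurs_before :
  compb 3 (fun xs => occurs_before (nth 0 xs 0) (nth 1 xs 0) (nth 2 xs 0)).
Proof.
  apply (compb_exists 3
    (fun ys => csnd (snth (nth 1 ys 0) (nth 0 ys 0)) =? nth 3 ys 0)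
    (fun xs => nth 1 xs 0)); [|apply comp_nth; lia].
  apply compb_eq; [apply comp_csnd, comp_snth|]; apply comp_nth; lia.
Qed.

Lemma compb_fold_forallb {A} k (P : A -> list nat -> bool) l :
  (forall a, compb k (P a)) -> compb k (fun xs => forallb (fun a => P a xs) l).
Proof.
  intros H. induction l as [|a l IH]; cbn; [apply compb_const|]. now apply compb_and.
Qed.

Lemma compb_fold_existsb {A} k (P : A -> list nat -> bool) l :
  (forall a, compb k (P a)) -> compb k (fun xs => existsb (fun a => P a xs) l).
Proof.
  intros H. induction l as [|a l IH]; cbn; [apply compb_const|]. now apply compb_or.
Qed.

Lemma comp_aev k F a : comp k F -> comp k (fun xs => aev (snth (F xs)) a).
Proof. intros HF. apply comp_cpair; [apply comp_const | now apply comp_pev]. Qed.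

Lemma compb_check cls :
  compb 3 (fun xs => check cls (nth 0 xs 0) (nth 1 xs 0) (nth 2 xs 0)).
Proof.
  unfold check. apply compb_and.
  - apply (compb_forall 3 (fun ys =>
      justified cls (occurs_before (csnd (nth 1 ys 0)) (nth 0 ys 0))
        (snth (csnd (nth 1 ys 0)) (nth 0 ys 0))) (fun xs => cfst (nth 0 xs 0)));
      [|apply comp_cfst, comp_nth; lia].
    set (X := fun ys => snth (csnd (nth 1 ys 0)) (nth 0 ys 0)).
    assert (HX : comp 4 X).
    { apply comp_snth; [apply comp_csnd|]; apply comp_nth; lia. }
    apply (compb_fold_existsb 4 (fun (c : clause) ys =>
      (csnd (X ys) =? aev (snth (cfst (X ys))) (fst c)) &&
      forallb (fun a => occurs_before (csnd (nth 1 ys 0)) (nth 0 ys 0)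
                          (aev (snth (cfst (X ys))) a)) (snd c))).
    intros c. apply compb_and.
    + apply compb_eq; [now apply comp_csnd | now apply comp_aev, comp_cfst].
    + apply (compb_fold_forallb 4 (fun a ys =>
        occurs_before (csnd (nth 1 ys 0)) (nth 0 ys 0) (aev (snth (cfst (X ys))) a))).
      intros a.
      apply (comp_app3 (fun s i v => Nat.b2n (occurs_before s i v)));
        [apply compb_occurs_before | apply comp_csnd, comp_nth; lia | apply comp_nth; lia
        | now apply comp_aev, comp_cfst].
  - apply (comp_app3 (fun s i v => Nat.b2n (occurs_before s i v)));
      [apply compb_occurs_before | apply comp_csnd | apply comp_cfst | apply comp_cpair];
      apply comp_nth; lia.
Qed.

Lemma occurs_before_spec s i v :
  occurs_before s i v = true <-> exists j, j < i /\ csnd (snth s j) = v.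
Proof.
  unfold occurs_before. rewrite existsb_exists. split; intros [j [H1 H2]]; exists j.
  - apply in_seq in H1. apply Nat.eqb_eq in H2. split; [lia | exact H2].
  - rewrite in_seq, Nat.eqb_eq. split; [lia | exact H2].
Qed.

Lemma justified_spec cls before x :
  justified cls before x = true <->
  exists h b, In (h, b) cls /\ csnd x = aev (snth (cfst x)) h /\
    forall a, In a b -> before (aev (snth (cfst x)) a) = true.
Proof.
  unfold justified. rewrite existsb_exists. split.
  - intros [[h b] [H1 H2]]. apply andb_prop in H2 as [H2 H3].
    apply Nat.eqb_eq in H2. rewrite forallb_forall in H3. eauto.
  - intros [h [b [H1 [H2 H3]]]]. exists (h, b). split; [exact H1|].
    rewrite andb_true_iff, Nat.eqb_eq, forallb_forall. auto.
Qed.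

(** Body atoms occur strictly before their head, so strong induction on positions rebuilds the
    derivation. *)
Lemma check_sound cls c tag v : check cls c tag v = true -> derives cls tag v.
Proof.
  unfold check. rewrite andb_true_iff, forallb_forall, occurs_before_spec.
  set (s := csnd c). intros [H [j [L E]]].
  enough (D : forall i, i < cfst c -> forall tag v, csnd (snth s i) = cpair tag v ->
              derives cls tag v) by eauto.
  clear j L E tag v. induction i as [i IH] using lt_wf_ind. intros L tag v E.
  specialize (H i ltac:(apply in_seq; lia)). apply justified_spec in H.
  destruct H as [h [b [H1 [H2 H3]]]]. rewrite E in H2.
  apply cpair_inj in H2 as [-> ->]. econstructor; [exact H1|].
  intros a Ha. apply H3, occurs_before_spec in Ha as [j [Lj Ej]].
  eapply (IH j); [lia | lia | exact Ej].
Qed.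

(** The certificate condition on uncoded lists, where certificates can be concatenated. *)
Definition valid (cls : list clause) (l : list nat) : Prop :=
  forall i, i < length l ->
    exists h b, In (h, b) cls /\ csnd (nth i l 0) = aev (snth (cfst (nth i l 0))) h /\
      forall a, In a b ->
        exists j, j < i /\ csnd (nth j l 0) = aev (snth (cfst (nth i l 0))) a.

Definition occurs (l : list nat) (v : nat) : Prop :=
  exists j, j < length l /\ csnd (nth j l 0) = v.

Lemma valid_app cls l m : valid cls l -> valid cls m -> valid cls (l ++ m).
Proof.
  intros Hl Hm i L. rewrite length_app in L.
  destruct (Nat.lt_ge_cases i (length l)) as [Li|Li].
  - rewrite app_nth1 by exact Li. destruct (Hl i Li) as [h [b [H1 [H2 H3]]]].
    exists h, b. repeat split; auto. intros a Ha. destruct (H3 a Ha) as [j [Lj Ej]].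
    exists j. rewrite app_nth1 by lia. auto.
  - rewrite app_nth2 by exact Li. destruct (Hm (i - length l)) as [h [b [H1 [H2 H3]]]]; [lia|].
    exists h, b. repeat split; auto. intros a Ha. destruct (H3 a Ha) as [j [Lj Ej]].
    exists (length l + j). rewrite app_nth2 by lia.
    replace (length l + j - length l) with j by lia. split; [lia | exact Ej].
Qed.

Lemma occurs_app_l l m v : occurs l v -> occurs (l ++ m) v.
Proof.
  intros [j [L E]]. exists j. rewrite length_app, app_nth1 by exact L. split; [lia | exact E].
Qed.

Lemma occurs_app_r l m v : occurs m v -> occurs (l ++ m) v.
Proof.
  intros [j [L E]]. exists (length l + j). rewrite length_app, app_nth2 by lia.
  replace (length l + j - length l) with j by lia. split; [lia | exact E].
Qed.

Lemma check_complete cls tag v : derives cls tag v -> exists c, check cls c tag v = true.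
Proof.
  intros D. enough (exists l, valid cls l /\ occurs l (cpair tag v)) as [l [V [j [L E]]]].
  { exists (cpair (length l) (senc l)). unfold check. rewrite csnd_cpair, cfst_cpair.
    rewrite andb_true_iff, forallb_forall, occurs_before_spec. split.
    - intros i Hi. apply in_seq in Hi. destruct (V i) as [h [b [H1 [H2 H3]]]]; [lia|].
      apply justified_spec. rewrite snth_senc by lia. exists h, b. repeat split; auto.
      intros a Ha. apply occurs_before_spec. destruct (H3 a Ha) as [k [Lk Ek]].
      exists k. rewrite snth_senc by lia. auto.
    - exists j. rewrite snth_senc; auto. }
  induction D as [h b e Hin _ IH].
  (* The certificates of the body atoms are merged by concatenation. *)
  assert (exists l, valid cls l /\ forall a, In a b -> occurs l (aev e a)) as [l [V O]].
  { clear Hin. induction b as [|a b IHb].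
    - exists []. split; [intros i Hi; cbn in Hi; lia | intros a []].
    - destruct IHb as [l [V O]]; [intros; apply IH; now right|].
      destruct (IH a (or_introl eq_refl)) as [m [Vm Om]]. exists (l ++ m). split.
      + now apply valid_app.
      + intros a' [<-|Ha]; [now apply occurs_app_r | now apply occurs_app_l, O]. }
  (* The entry appended last records the clause instance, with its environment cut off at the
     variables of the clause. *)
  set (n := clause_bound (h, b)).
  set (x := cpair (restrict_env e n) (aev e h)).
  assert (Hx : nth (length l) (l ++ [x]) 0 = x).
  { rewrite app_nth2, Nat.sub_diag; auto. }
  assert (R : forall a, a = h \/ In a b -> aev (snth (cfst x)) a = aev e a).
  { intros a Ha. unfold aev, x. rewrite cfst_cpair, pev_restrict; [reflexivity|].
    now apply clause_bound_spec. }
  exists (l ++ [x]). split.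
  - intros i Hi. rewrite length_app in Hi. cbn in Hi.
    destruct (Nat.eq_dec i (length l)) as [->|Ni].
    + rewrite Hx. exists h, b. split; [exact Hin|]. split.
      * rewrite R by auto. apply csnd_cpair.
      * intros a Ha. rewrite R by auto. destruct (O a Ha) as [j [Lj Ej]].
        exists j. rewrite app_nth1 by exact Lj. auto.
    + rewrite app_nth1 by lia. destruct (V i) as [h' [b' [H1 [H2 H3]]]]; [lia|].
      exists h', b'. repeat split; auto. intros a Ha. destruct (H3 a Ha) as [j [Lj Ej]].
      exists j. rewrite app_nth1 by lia. auto.
  - exists (length l). rewrite length_app, Hx. split; [cbn; lia | apply csnd_cpair].
Qed.

Theorem derives_iff_check cls tag v :
  derives cls tag v <-> exists c, check cls c tag v = true.
Proof.
  split; [apply check_complete | intros [c H]; exact (check_sound _ _ _ _ H)].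
Qed.

(** * Terms and rewriting *)

Section TermInd.
  Variable P : term -> Prop.
  Hypothesis HV : forall x, P (Var x).
  Hypothesis HF : forall f ts, Forall P ts -> P (Fun f ts).

  Fixpoint term_ind_forall (t : term) : P t :=
    match t with
    | Var x => HV x
    | Fun f ts =>
        HF f ts ((fix go (l : list term) : Forall P l :=
                    match l with
                    | [] => Forall_nil P
                    | u :: l' => Forall_cons u (term_ind_forall u) (go l')
                    end) ts)
    end.
End TermInd.

Lemma wf_term_fun sg f ts :
  wf_term sg (Fun f ts) <-> In (f, length ts) sg /\ Forall (wf_term sg) ts.
Proof.
  cbn. apply and_iff_compat_l. induction ts as [|u ts IH].
  - split; auto.
  - rewrite IH, Forall_cons_iff. reflexivity.
Qed.

Lemma vars_fun f ts : vars (Fun f ts) = flat_map vars ts.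
Proof. cbn. induction ts as [|u ts IH]; cbn; congruence. Qed.

Lemma subst_ext s s' t :
  (forall x, In x (vars t) -> s x = s' x) -> subst s t = subst s' t.
Proof.
  induction t as [x|f ts IH] using term_ind_forall; intros H.
  - apply H. now left.
  - cbn [subst]. f_equal. apply map_ext_in. intros u Hu.
    rewrite Forall_forall in IH. apply IH; [exact Hu|]. intros x Hx. apply H.
    rewrite vars_fun. apply in_flat_map. eauto.
Qed.

(** A step in exactly one argument, in a form that recurses along the list, as the Horn clauses
    do. *)
Inductive lstep (R : trs) : list term -> list term -> Prop :=
| lstep_hd t u ts : rstep R t u -> lstep R (t :: ts) (u :: ts)
| lstep_tl t ts us : lstep R ts us -> lstep R (t :: ts) (t :: us).

Lemma lstep_ctx R f ts us : lstep R ts us -> rstep R (Fun f ts) (Fun f us).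
Proof.
  intros H. enough (exists a t u b, ts = a ++ t :: b /\ us = a ++ u :: b /\ rstep R t u)
    as (a & t & u & b & -> & -> & Hs) by now constructor.
  induction H as [t u ts H|t ts us _ (a & v & w & b & -> & -> & Hs)].
  - exists [], t, u, ts. auto.
  - exists (t :: a), v, w, b. auto.
Qed.

Lemma lstep_app R a t u b : rstep R t u -> lstep R (a ++ t :: b) (a ++ u :: b).
Proof. intros H. induction a; cbn; now constructor. Qed.

Lemma rstep_inv R t u :
  rstep R t u ->
  (exists l r s, In (l, r) (trs_rules R) /\ t = subst s l /\ u = subst s r) \/
  (exists f ts us, t = Fun f ts /\ u = Fun f us /\ lstep R ts us).
Proof.
  destruct 1 as [l r s H|f a t u b H].
  - left. exists l, r, s. auto.
  - right. exists f, (a ++ t :: b), (a ++ u :: b). auto using lstep_app.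
Qed.

(** * Injectivity and inversion of the codings *)

Definition codes (ts : list term) : nat := code_list (map code_term ts).
Definition code_sig (sg : signature) : nat :=
  code_list (map (fun p => cpair (fst p) (snd p)) sg).
Definition code_rules (rs : list (term * term)) : nat :=
  code_list (map (fun p => cpair (code_term (fst p)) (code_term (snd p))) rs).

Lemma code_trs_eq R : code_trs R = cpair (code_sig (trs_sig R)) (code_rules (trs_rules R)).
Proof. reflexivity. Qed.

(** Injectivity is assumed only at the members of [l], so that the induction hypothesis for the
    arguments of a term can be supplied. *)
Lemma code_list_map_inj {A} (f : A -> nat) l :
  Forall (fun x => forall y, f x = f y -> x = y) l ->
  forall m, code_list (map f l) = code_list (map f m) -> l = m.
Proof.
  induction 1 as [|x l Hx _ IH]; intros [|y m] E; try discriminate; [reflexivity|].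
  cbn in E. injection E as E. apply cpair_inj in E as [E1 E2].
  rewrite (Hx y E1). f_equal. auto.
Qed.

Lemma code_term_inj t u : code_term t = code_term u -> t = u.
Proof.
  revert u. induction t as [x|f ts IH] using term_ind_forall; intros [y|g us] E;
    cbn [code_term] in E; apply cpair_inj in E as [E1 E]; try discriminate.
  - congruence.
  - apply cpair_inj in E as [-> E]. f_equal. now apply code_list_map_inj in E.
Qed.

Lemma code_sig_inj s s' : code_sig s = code_sig s' -> s = s'.
Proof.
  apply code_list_map_inj, Forall_forall. intros [a b] _ [c d] E.
  cbn in E. apply cpair_inj in E as [-> ->]. reflexivity.
Qed.

Lemma code_rules_inj s s' : code_rules s = code_rules s' -> s = s'.
Proof.
  apply code_list_map_inj, Forall_forall. intros [a b] _ [c d] E.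
  cbn in E. apply cpair_inj in E as [E1 E2]. f_equal; now apply code_term_inj.
Qed.

Lemma code_trs_inj R R' : code_trs R = code_trs R' -> R = R'.
Proof.
  rewrite !code_trs_eq. intros E. apply cpair_inj in E as [E1 E2].
  destruct R, R'. f_equal; [now apply code_sig_inj | now apply code_rules_inj].
Qed.

Lemma code_term_var_inv t x : code_term t = cpair 0 x -> t = Var x.
Proof. intros E. now apply (code_term_inj t (Var x)). Qed.

Lemma code_term_fun_inv t f l :
  code_term t = cpair 1 (cpair f l) -> exists ts, t = Fun f ts /\ l = codes ts.
Proof.
  destruct t as [x|g ts]; cbn; intros E; apply cpair_inj in E as [E1 E]; [discriminate|].
  apply cpair_inj in E as [-> <-]. now exists ts.
Qed.

Lemma code_list_map_nil_inv {A} (f : A -> nat) l : code_list (map f l) = 0 -> l = [].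
Proof. destruct l; [reflexivity | discriminate]. Qed.

Lemma code_list_map_cons_inv {A} (f : A -> nat) l a m :
  code_list (map f l) = S (cpair a m) ->
  exists x l', l = x :: l' /\ a = f x /\ m = code_list (map f l').
Proof.
  destruct l as [|x l]; cbn; intros E; [discriminate|].
  injection E as E. apply cpair_inj in E as [<- <-]. eauto.
Qed.

(** * Rewriting as a Horn program *)

Definition pcons (p q : pat) : pat := PS (PP p q).
Definition pfun (f l : pat) : pat := PP (PC 1) (PP f l).
Definition PT (p q r : pat) : pat := PP p (PP q r).

Definition tMem := 0.   Definition tNth := 1.    Definition tTerm := 2.
Definition tTerms := 3. Definition tSub := 4.    Definition tSubs := 5.
Definition tStep := 6.  Definition tStepl := 7.  Definition tSteps := 8.
Definition tLen := 9.   Definition tOcc := 10.   Definition tOccl := 11.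
Definition tWf := 12.   Definition tWfl := 13.   Definition tSig := 14.
Definition tRules := 15. Definition tTrs := 16.  Definition tPeak := 17.
Definition tJoin := 18.

Section Program.
Local Notation "'$' i" := (PV i) (at level 0, i at level 0).
Local Notation "h '<--' b" := ((h, b) : clause) (at level 95).

Definition mem_here := (tMem, PP $0 (pcons $0 $1)) <-- [].
Definition mem_there := (tMem, PP $0 (pcons $1 $2)) <-- [(tMem, PP $0 $2)].
Definition nth_here := (tNth, PT (pcons $0 $1) (PC 0) $0) <-- [].
Definition nth_there := (tNth, PT (pcons $0 $1) (PS $2) $3) <-- [(tNth, PT $1 $2 $3)].
Definition term_var := (tTerm, PP (PC 0) $0) <-- [].
Definition term_fun := (tTerm, pfun $0 $1) <-- [(tTerms, $1)].
Definition terms_nil := (tTerms, PC 0) <-- [].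
Definition terms_cons := (tTerms, pcons $0 $1) <-- [(tTerm, $0); (tTerms, $1)].
Definition sub_var := (tSub, PT $0 (PP (PC 0) $1) $2) <-- [(tNth, PT $0 $1 $2)].
Definition sub_fun :=
  (tSub, PT $0 (pfun $1 $2) (pfun $1 $3)) <-- [(tSubs, PT $0 $2 $3)].
Definition subs_nil := (tSubs, PT $0 (PC 0) (PC 0)) <-- [].
Definition subs_cons :=
  (tSubs, PT $0 (pcons $1 $2) (pcons $3 $4)) <-- [(tSub, PT $0 $1 $3); (tSubs, PT $0 $2 $4)].
(** The substitution is guessed as a list of terms [$6], and the rule [$4], [$5] as a member of the
    rule list. *)
Definition step_root :=
  (tStep, PT (PP $0 $1) $2 $3) <--
    [(tMem, PP (PP $4 $5) $1); (tTerms, $6); (tSub, PT $6 $4 $2); (tSub, PT $6 $5 $3)].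
Definition step_arg :=
  (tStep, PT $0 (pfun $1 $2) (pfun $1 $3)) <-- [(tStepl, PT $0 $2 $3)].
Definition stepl_here :=
  (tStepl, PT $0 (pcons $1 $2) (pcons $3 $2)) <-- [(tStep, PT $0 $1 $3)].
Definition stepl_there :=
  (tStepl, PT $0 (pcons $1 $2) (pcons $1 $3)) <-- [(tStepl, PT $0 $2 $3)].
Definition steps_refl := (tSteps, PT $0 $1 $1) <-- [].
Definition steps_cons :=
  (tSteps, PT $0 $1 $2) <-- [(tStep, PT $0 $1 $3); (tSteps, PT $0 $3 $2)].
Definition len_nil := (tLen, PP (PC 0) (PC 0)) <-- [].
Definition len_cons := (tLen, PP (pcons $0 $1) (PS $2)) <-- [(tLen, PP $1 $2)].
Definition occ_var := (tOcc, PP $0 (PP (PC 0) $0)) <-- [].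
Definition occ_fun := (tOcc, PP $0 (pfun $1 $2)) <-- [(tOccl, PP $0 $2)].
Definition occl_here := (tOccl, PP $0 (pcons $1 $2)) <-- [(tOcc, PP $0 $1)].
Definition occl_there := (tOccl, PP $0 (pcons $1 $2)) <-- [(tOccl, PP $0 $2)].
(* [tWf (sg, b, t)]: [t] is well formed and its variables occur in [b]; with [b] ground
   this is groundness, with [b] a left-hand side it is the variable condition on rules. *)
Definition wf_var := (tWf, PT $0 $1 (PP (PC 0) $2)) <-- [(tOcc, PP $2 $1)].
Definition wf_fun :=
  (tWf, PT $0 $1 (pfun $2 $3)) <--
    [(tLen, PP $3 $4); (tMem, PP (PP $2 $4) $0); (tWfl, PT $0 $1 $3)].
Definition wfl_nil := (tWfl, PT $0 $1 (PC 0)) <-- [].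
Definition wfl_cons :=
  (tWfl, PT $0 $1 (pcons $2 $3)) <-- [(tWf, PT $0 $1 $2); (tWfl, PT $0 $1 $3)].
Definition sig_nil := (tSig, PC 0) <-- [].
Definition sig_cons := (tSig, pcons (PP $0 $1) $2) <-- [(tSig, $2)].
Definition rules_nil := (tRules, PP $0 (PC 0)) <-- [].
Definition rules_cons :=
  (tRules, PP $0 (pcons (PP (pfun $1 $2) $3) $4)) <--
    [(tTerm, pfun $1 $2); (tTerm, $3); (tWf, PT $0 (pfun $1 $2) (pfun $1 $2));
     (tWf, PT $0 (pfun $1 $2) $3); (tRules, PP $0 $4)].
Definition trs_intro := (tTrs, PP $0 $1) <-- [(tSig, $0); (tRules, PP $0 $1)].
(** [pfun (PC 0) (PC 0)] codes [Fun 0 []], which has no variables, so [tWf] forces [$4] to be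
    ground. *)
Definition peak_intro :=
  (tPeak, PP (PP $0 $1) (PP $2 $3)) <--
    [(tTerm, $4); (tWf, PT $0 (pfun (PC 0) (PC 0)) $4);
     (tStep, PT (PP $0 $1) $4 $2); (tStep, PT (PP $0 $1) $4 $3)].
Definition join_intro :=
  (tJoin, PT $0 $1 $2) <-- [(tSteps, PT $0 $1 $3); (tSteps, PT $0 $2 $3)].

Definition rewriting : list clause :=
  [mem_here; mem_there; nth_here; nth_there; term_var; term_fun; terms_nil; terms_cons;
   sub_var; sub_fun; subs_nil; subs_cons; step_root; step_arg; stepl_here; stepl_there;
   steps_refl; steps_cons; len_nil; len_cons; occ_var; occ_fun; occl_here; occl_there;
   wf_var; wf_fun; wfl_nil; wfl_cons; sig_nil; sig_cons; rules_nil; rules_cons;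
   trs_intro; peak_intro; join_intro].

End Program.

(** In derivations the default is never reached, because [tNth] is not derivable out of range. *)
Definition lsubst (ss : list term) (x : nat) : term := nth x ss (Var 0).

(* The cases are the tags [tMem], ..., [tJoin] in order. *)
Definition meaning (tag v : nat) : Prop :=
  match tag with
  | 0 => forall x l, v = cpair x (code_list l) -> In x l
  | 1 => forall l i x, v = cpair (code_list l) (cpair i x) -> nth_error l i = Some x
  | 2 => exists t, v = code_term t
  | 3 => exists ts, v = codes ts
  | 4 => forall ss t u, v = cpair (codes ss) (cpair (code_term t) u) ->
           u = code_term (subst (lsubst ss) t)
  | 5 => forall ss ts u, v = cpair (codes ss) (cpair (codes ts) u) ->
           u = codes (map (subst (lsubst ss)) ts)
  | 6 => forall R t u, v = cpair (code_trs R) (cpair (code_term t) u) ->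
           exists u', u = code_term u' /\ rstep R t u'
  | 7 => forall R ts u, v = cpair (code_trs R) (cpair (codes ts) u) ->
           exists us, u = codes us /\ lstep R ts us
  | 8 => forall R t u, v = cpair (code_trs R) (cpair (code_term t) u) ->
           exists u', u = code_term u' /\ rsteps R t u'
  | 9 => forall l n, v = cpair (code_list l) n -> n = length l
  | 10 => forall x t, v = cpair x (code_term t) -> In x (vars t)
  | 11 => forall x ts, v = cpair x (codes ts) -> In x (flat_map vars ts)
  | 12 => forall sg b t, v = cpair (code_sig sg) (cpair (code_term b) (code_term t)) ->
            wf_term sg t /\ incl (vars t) (vars b)
  | 13 => forall sg b ts, v = cpair (code_sig sg) (cpair (code_term b) (codes ts)) ->
            Forall (wf_term sg) ts /\ incl (flat_map vars ts) (vars b)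
  | 14 => exists sg, v = code_sig sg
  | 15 => forall sg w, v = cpair (code_sig sg) w ->
            exists rs, w = code_rules rs /\ wf_trs (mkTRS sg rs)
  | 16 => exists R, v = code_trs R /\ wf_trs R
  | 17 => forall R w, v = cpair (code_trs R) w ->
            exists t t1 t2, w = cpair (code_term t1) (code_term t2) /\
              ground_term (trs_sig R) t /\ rstep R t t1 /\ rstep R t t2
  | 18 => forall R t1 t2, v = cpair (code_trs R) (cpair (code_term t1) (code_term t2)) ->
            exists d, rsteps R t1 d /\ rsteps R t2 d
  | _ => True
  end.

Ltac uncode :=
  repeat match goal with
  | H : cpair _ _ = cpair _ _ |- _ => apply cpair_inj in H as [? ?]
  | H : cpair _ _ = code_trs _ |- _ => rewrite code_trs_eq in H
  | H : cpair _ _ = code_term _ |- _ => symmetry in H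
  | H : S _ = code_list _ |- _ => symmetry in H
  | H : S _ = codes _ |- _ => symmetry in H
  | H : 0 = code_list _ |- _ => symmetry in H
  | H : 0 = codes _ |- _ => symmetry in H
  | H : code_term _ = cpair 0 _ |- _ => apply code_term_var_inv in H
  | H : code_term _ = cpair 1 (cpair _ _) |- _ => apply code_term_fun_inv in H as [? [? ?]]
  | H : codes _ = 0 |- _ => apply code_list_map_nil_inv in H
  | H : codes _ = S (cpair _ _) |- _ =>
      apply code_list_map_cons_inv in H as [? [? [? [? ?]]]]
  | H : code_list ?l = 0 |- _ => destruct l; [clear H | discriminate H]
  | H : code_list ?l = S (cpair _ _) |- _ =>
      destruct l; [discriminate H | cbn [code_list] in H; injection H as H]
  end; subst.

(** Most meanings are conditional: if the inputs are codes, so are the outputs, and the relation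
    holds. The clauses therefore need not check codes throughout; premises such as [tTerm] and
    [tTerms] vouch for guessed values. *)
Lemma rewriting_sound tag v : derives rewriting tag v -> meaning tag v.
Proof.
  induction 1 as [h b e Hin Hb IH]. clear Hb.
  assert (IH' : Forall (fun a => meaning (fst a) (pev e (snd a))) b) by now apply Forall_forall.
  clear IH. unfold rewriting in Hin. cbn [In] in Hin.
  repeat destruct Hin as [Hin|Hin]; try contradiction; injection Hin as <- <-;
    repeat match goal with
      | H : Forall _ (_ :: _) |- _ => apply Forall_cons_iff in H as [? H]
      | H : Forall _ [] |- _ => clear H
      end; cbn [fst snd pev meaning tMem tNth tTerm tTerms tSub tSubs tStep tStepl tSteps
      tLen tOcc tOccl tWf tWfl tSig tRules tTrs tPeak tJoin pcons pfun PT] in *.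
  (* The values of the pattern variables, none beyond [$6], become plain variables that [uncode] can
     substitute. *)
  all: intros; set (z0 := e 0) in *; set (z1 := e 1) in *; set (z2 := e 2) in *;
    set (z3 := e 3) in *; set (z4 := e 4) in *; set (z5 := e 5) in *; set (z6 := e 6) in *;
    clearbody z0 z1 z2 z3 z4 z5 z6; clear e; uncode.
  - now left.
  - right. eauto.
  - reflexivity.
  - cbn. eauto.
  - now exists (Var z0).
  - destruct H as [ts ->]. now exists (Fun z0 ts).
  - now exists [].
  - destruct H as [t ->], H0 as [ts ->]. now exists (t :: ts).
  - specialize (H _ _ _ eq_refl). rewrite nth_error_map in H.
    destruct (nth_error ss z1) as [t|] eqn:Et; [|discriminate]. injection H as <-.
    cbn. unfold lsubst. now rewrite (nth_error_nth _ _ _ Et).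
  - rewrite (H _ _ _ eq_refl). reflexivity.
  - reflexivity.
  - rewrite (H _ _ _ eq_refl), (H0 _ _ _ eq_refl). reflexivity.
  - destruct H0 as [ss ->]. specialize (H _ _ eq_refl).
    apply in_map_iff in H as [[l r] [E Hin]]. cbn in E. apply cpair_inj in E as [<- <-].
    specialize (H1 _ _ _ eq_refl). apply code_term_inj in H1 as ->.
    exists (subst (lsubst ss) r). split; [now rewrite (H2 _ _ _ eq_refl) | now constructor].
  - destruct (H _ _ _ eq_refl) as [us [-> Hs]]. exists (Fun z1 us).
    split; [reflexivity | now apply lstep_ctx].
  - destruct (H _ _ _ eq_refl) as [w [-> Hs]]. exists (w :: x0).
    split; [reflexivity | now constructor].
  - destruct (H _ _ _ eq_refl) as [us [-> Hs]]. exists (x :: us).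
    split; [reflexivity | now constructor].
  - exists t. split; [reflexivity | apply rt_refl].
  - destruct (H _ _ _ eq_refl) as [v [-> Hs]].
    destruct (H0 _ _ _ eq_refl) as [w [-> Hw]]. exists w. split; [reflexivity|].
    eapply rt_trans; [apply rt_step|]; eassumption.
  - reflexivity.
  - cbn. f_equal. eauto.
  - now left.
  - rewrite vars_fun. eauto.
  - cbn. apply in_or_app. eauto.
  - cbn. apply in_or_app. eauto.
  - split; [exact I|]. intros y [<-|[]]. eauto.
  - destruct (H1 _ _ _ eq_refl) as [W V]. rewrite wf_term_fun, vars_fun.
    split; [split; [|exact W] | exact V]. rewrite (H _ _ eq_refl) in H0. unfold codes in *.
    rewrite length_map in H0. specialize (H0 _ _ eq_refl).
    apply in_map_iff in H0 as [[f k] [E Hin]]. cbn in E. now apply cpair_inj in E as [-> ->].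
  - split; [constructor | intros y []].
  - destruct (H _ _ _ eq_refl) as [W V]. destruct (H0 _ _ _ eq_refl) as [Ws Vs].
    split; [now constructor|]. cbn. now apply incl_app.
  - now exists [].
  - destruct H as [sg ->]. now exists ((z0, z1) :: sg).
  - exists []. split; [reflexivity | intros l r []].
  - destruct H as [l El], H0 as [r ->]. rewrite El in *.
    destruct (H1 _ _ _ eq_refl) as [Wl _], (H2 _ _ _ eq_refl) as [Wr V].
    destruct (H3 _ _ eq_refl) as [rs [-> W]]. exists ((l, r) :: rs).
    split; [reflexivity|]. symmetry in El. apply code_term_fun_inv in El as [ts [-> _]].
    intros l' r' [E|Hin]; [|now apply W]. injection E as <- <-.
    split; [exact Wl|]. split; [exact Wr|]. split; [discriminate | exact V].
  - destruct H as [sg ->]. destruct (H0 _ _ eq_refl) as [rs [-> W]].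
    now exists (mkTRS sg rs).
  - destruct H as [t ->]. destruct (H0 _ (Fun 0 []) _ eq_refl) as [W V].
    rewrite <- code_trs_eq in *.
    destruct (H1 _ _ _ eq_refl) as [t1 [-> S1]], (H2 _ _ _ eq_refl) as [t2 [-> S2]].
    exists t, t1, t2. repeat split; auto. now apply incl_l_nil.
  - destruct (H _ _ _ eq_refl) as [u [-> Hu]]. destruct (H0 _ _ _ eq_refl) as [w [E Hw]].
    apply code_term_inj in E as <-. eauto.
Qed.

(** * Completeness of the Horn program *)

Lemma derives_clause c l :
  In c rewriting ->
  Forall (fun a => derives rewriting (fst a) (pev (fun i => nth i l 0) (snd a))) (snd c) ->
  derives rewriting (fst (fst c)) (pev (fun i => nth i l 0) (snd (fst c))).
Proof.
  destruct c as [h b]. intros Hin Hb. apply (derives_intro _ h b); [exact Hin|].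
  now apply Forall_forall.
Qed.

(** The list [l] gives the values of [$0], [$1], ... in order. *)
Ltac by_clause c l :=
  apply (derives_clause c l);
  [ unfold rewriting; cbn [In]; repeat first [left; reflexivity | right]
  | repeat first [apply Forall_nil | apply Forall_cons];
    cbn [fst snd pev nth pcons pfun PT] ].

Local Notation D := (derives rewriting).

Lemma derives_mem x l : In x l -> D tMem (cpair x (code_list l)).
Proof.
  induction l as [|y l IH]; intros H; [destruct H | destruct H as [->|H]].
  - by_clause mem_here [x; code_list l].
  - by_clause mem_there [x; y; code_list l]. auto.
Qed.

Lemma derives_nth l i x :
  nth_error l i = Some x -> D tNth (cpair (code_list l) (cpair i x)).
Proof.
  revert i. induction l as [|y l IH]; intros [|i] H; try discriminate; cbn in H.
  - injection H as ->. by_clause nth_here [x; code_list l].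
  - by_clause nth_there [y; code_list l; i; x]. auto.
Qed.

Lemma derives_terms ts : Forall (fun t => D tTerm (code_term t)) ts -> D tTerms (codes ts).
Proof.
  induction 1 as [|t ts Ht _ IH].
  - by_clause terms_nil (@nil nat).
  - by_clause terms_cons [code_term t; codes ts]; auto.
Qed.

Lemma derives_term t : D tTerm (code_term t).
Proof.
  induction t as [x|f ts IH] using term_ind_forall.
  - by_clause term_var [x].
  - by_clause term_fun [f; codes ts]. now apply derives_terms.
Qed.

Lemma derives_sub ss t :
  (forall x, In x (vars t) -> x < length ss) ->
  D tSub (cpair (codes ss) (cpair (code_term t) (code_term (subst (lsubst ss) t)))).
Proof.
  induction t as [x|f ts IH] using term_ind_forall; intros H.
  - by_clause sub_var [codes ss; x; code_term (lsubst ss x)].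
    apply derives_nth, map_nth_error, nth_error_nth'. apply H. now left.
  - by_clause sub_fun [codes ss; f; codes ts; codes (map (subst (lsubst ss)) ts)].
    rewrite vars_fun in H. induction IH as [|t ts Ht _ IHts].
    + by_clause subs_nil [codes ss].
    + by_clause subs_cons [codes ss; code_term t; codes ts;
        code_term (subst (lsubst ss) t); codes (map (subst (lsubst ss)) ts)].
      * apply Ht. intros x Hx. apply H. cbn. apply in_or_app. auto.
      * apply IHts. intros x Hx. apply H. cbn. apply in_or_app. auto.
Qed.

Lemma derives_step R t u :
  rstep R t u -> D tStep (cpair (code_trs R) (cpair (code_term t) (code_term u))).
Proof.
  induction 1 as [l r s Hin|f ts1 t u ts2 _ IH].
  (* The substitution is tabulated far enough for both sides of the rule; the variables of [r] are
     counted separately, as [R] is an arbitrary TRS here. *)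
  - set (n := S (list_max (vars l ++ vars r))).
    set (ss := map s (seq 0 n)).
    assert (B : forall x, In x (vars l ++ vars r) -> x < n).
    { intros x Hx. pose proof (proj1 (list_max_le (vars l ++ vars r) _) (le_n _)) as F.
      rewrite Forall_forall in F. apply F in Hx. unfold n. lia. }
    assert (E : forall t, incl (vars t) (vars l ++ vars r) ->
              subst s t = subst (lsubst ss) t /\ forall x, In x (vars t) -> x < length ss).
    { intros t Ht. split.
      - apply subst_ext. intros x Hx. apply Ht, B in Hx. unfold lsubst, ss.
        rewrite (nth_indep _ (Var 0) (s 0)) by (rewrite length_map, length_seq; lia).
        now rewrite map_nth, seq_nth.
      - intros x Hx. unfold ss. rewrite length_map, length_seq. auto. }
    destruct (E l) as [-> Bl]; [now apply incl_appl|].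
    destruct (E r) as [-> Br]; [now apply incl_appr|].
    by_clause step_root [code_sig (trs_sig R); code_rules (trs_rules R);
      code_term (subst (lsubst ss) l); code_term (subst (lsubst ss) r);
      code_term l; code_term r; codes ss].
    + apply derives_mem. exact (in_map _ _ _ Hin).
    + apply derives_terms, Forall_forall. intros t _. apply derives_term.
    + now apply derives_sub.
    + now apply derives_sub.
  - by_clause step_arg [code_trs R; f; codes (ts1 ++ t :: ts2); codes (ts1 ++ u :: ts2)].
    induction ts1 as [|v ts1 IHts]; cbn [app].
    + by_clause stepl_here [code_trs R; code_term t; codes ts2; code_term u]. exact IH.
    + by_clause stepl_there [code_trs R; code_term v; codes (ts1 ++ t :: ts2);
        codes (ts1 ++ u :: ts2)]. exact IHts.
Qed.

Lemma derives_steps R t u :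
  rsteps R t u -> D tSteps (cpair (code_trs R) (cpair (code_term t) (code_term u))).
Proof.
  intros H. apply clos_rt_rt1n in H. induction H as [t|t u v Hs _ IH].
  - by_clause steps_refl [code_trs R; code_term t].
  - by_clause steps_cons [code_trs R; code_term t; code_term v; code_term u]; auto.
    now apply derives_step.
Qed.

Lemma derives_len l : D tLen (cpair (code_list l) (length l)).
Proof.
  induction l as [|x l IH].
  - by_clause len_nil (@nil nat).
  - by_clause len_cons [x; code_list l; length l]. exact IH.
Qed.

Lemma derives_occ x t : In x (vars t) -> D tOcc (cpair x (code_term t)).
Proof.
  induction t as [y|f ts IH] using term_ind_forall; intros H.
  - destruct H as [->|[]]. by_clause occ_var [x].
  - by_clause occ_fun [x; f; codes ts]. rewrite vars_fun in H.
    induction IH as [|t ts Ht _ IHts]; [destruct H|].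
    apply in_app_or in H as [H|H].
    + by_clause occl_here [x; code_term t; codes ts]. auto.
    + by_clause occl_there [x; code_term t; codes ts]. auto.
Qed.

Lemma derives_wf sg b t :
  wf_term sg t -> incl (vars t) (vars b) ->
  D tWf (cpair (code_sig sg) (cpair (code_term b) (code_term t))).
Proof.
  induction t as [x|f ts IH] using term_ind_forall; intros W V.
  - by_clause wf_var [code_sig sg; code_term b; x]. apply derives_occ, V. now left.
  - rewrite wf_term_fun in W. rewrite vars_fun in V. destruct W as [Hf W].
    by_clause wf_fun [code_sig sg; code_term b; f; codes ts; length ts].
    + rewrite <- (length_map code_term ts). apply derives_len.
    + apply derives_mem. exact (in_map (fun p => cpair (fst p) (snd p)) _ _ Hf).
    + clear Hf. induction IH as [|t ts Ht _ IHts].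
      * by_clause wfl_nil [code_sig sg; code_term b].
      * apply Forall_cons_iff in W as [Wt W]. cbn in V. apply incl_app_inv in V as [Vt V].
        by_clause wfl_cons [code_sig sg; code_term b; code_term t; codes ts]; auto.
Qed.

Lemma derives_trs R : wf_trs R -> D tTrs (code_trs R).
Proof.
  intros W. by_clause trs_intro [code_sig (trs_sig R); code_rules (trs_rules R)].
  - clear W. induction (trs_sig R) as [|[f k] sg IH].
    + by_clause sig_nil (@nil nat).
    + by_clause sig_cons [f; k; code_sig sg]. exact IH.
  - destruct R as [sg rs]. cbn [trs_sig trs_rules]. induction rs as [|[l r] rs IH].
    + by_clause rules_nil [code_sig sg].
    + destruct (W l r) as [Wl [Wr [Nl V]]]; [now left|].
      destruct l as [x|f ts]; [now destruct (Nl x)|]. cbn [trs_sig] in *.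
      by_clause rules_cons [code_sig sg; f; codes ts; code_term r; code_rules rs].
      * apply (derives_term (Fun f ts)).
      * apply derives_term.
      * apply (derives_wf sg (Fun f ts) (Fun f ts)); [exact Wl | apply incl_refl].
      * now apply (derives_wf sg (Fun f ts) r).
      * apply IH. intros l' r' H. apply W. now right.
Qed.

Lemma derives_peak R t t1 t2 :
  ground_term (trs_sig R) t -> rstep R t t1 -> rstep R t t2 ->
  D tPeak (cpair (code_trs R) (cpair (code_term t1) (code_term t2))).
Proof.
  intros [W V] H1 H2.
  by_clause peak_intro [code_sig (trs_sig R); code_rules (trs_rules R); code_term t1;
    code_term t2; code_term t].
  - apply derives_term.
  - apply (derives_wf (trs_sig R) (Fun 0 []) t); [exact W|]. rewrite V. apply incl_nil_l.
  - now apply derives_step.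
  - now apply derives_step.
Qed.

Lemma derives_join R t1 t2 d :
  rsteps R t1 d -> rsteps R t2 d ->
  D tJoin (cpair (code_trs R) (cpair (code_term t1) (code_term t2))).
Proof.
  intros H1 H2. by_clause join_intro [code_trs R; code_term t1; code_term t2; code_term d];
    now apply derives_steps.
Qed.

(** * Membership in the class *)

Lemma WGC_codes_derives n :
  WGC_codes n <->
  D tTrs n /\ forall q, D tPeak (cpair n q) -> D tJoin (cpair n q).
Proof.
  split.
  - intros [R [W [<- C]]]. split; [now apply derives_trs|]. intros q H.
    (* Soundness shows that a derivable peak consists of codes of terms, so [q] may range over all
       numbers. *)
    apply rewriting_sound in H.
    destruct (H R q eq_refl) as [t [t1 [t2 [-> [G [H1 H2]]]]]].
    destruct (C t G t1 t2 H1 H2) as [d [J1 J2]]. exact (derives_join R t1 t2 d J1 J2).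
  - intros [W H]. apply rewriting_sound in W as [R [-> W]]. exists R.
    split; [exact W|]. split; [reflexivity|]. intros t G t1 t2 H1 H2.
    pose proof (H _ (derives_peak R t t1 t2 G H1 H2)) as J.
    exact (rewriting_sound _ _ J R t1 t2 eq_refl).
Qed.

Lemma WGC_codes_Pi2 : Pi0 2 WGC_codes.
Proof.
  set (chk := check rewriting).
  (* The universal [x] pairs a certificate of a peak with the peak itself; the existential [y] pairs
     certificates of well-formedness and of joinability. *)
  set (M := fun y x n : nat =>
    chk (cfst y) tTrs n &&
    (negb (chk (cfst x) tPeak (cpair n (csnd x))) ||
     chk (csnd y) tJoin (cpair n (csnd x)))).
  exists (fun xs => exists y, M y (nth 0 xs 0) (nth 1 xs 0) = true). split.
  - exists (fun xs => M (nth 0 xs 0) (nth 1 xs 0) (nth 2 xs 0) = true). split.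
    + assert (HM : compb 3 (fun xs => M (nth 0 xs 0) (nth 1 xs 0) (nth 2 xs 0))).
      { assert (HC : forall F G H, comp 3 F -> comp 3 G -> comp 3 H ->
                  compb 3 (fun xs => chk (F xs) (G xs) (H xs))).
        { intros F G H. apply (comp_app3 (fun c t v => Nat.b2n (chk c t v))).
          apply compb_check. }
        unfold M. apply compb_and; [|apply compb_or; [apply compb_neg|]]; apply HC;
          repeat first [apply comp_nth; lia | apply comp_const | apply comp_cpair
                       | apply comp_cfst | apply comp_csnd]. }
      destruct HM as [p Hp]. exists p. intros xs L. specialize (Hp xs L). cbn beta in Hp.
      destruct (M _ _ _); split; intros H; try exact Hp; [now destruct H | discriminate H].
    + intros [|x [|n [|]]] L; try discriminate. reflexivity.
  - intros [|n [|]] L; try discriminate. cbn [hd nth]. rewrite WGC_codes_derives. split.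
    + intros [W H] x. apply derives_iff_check in W as [c Hc].
      destruct (chk (cfst x) tPeak (cpair n (csnd x))) eqn:E.
      * apply check_sound, H, check_complete in E as [c' Hc'].
        exists (cpair c c'). unfold M, chk. rewrite cfst_cpair, csnd_cpair, Hc, Hc'.
        apply orb_true_r.
      (* No peak is certified by [x], so the second component is arbitrary. *)
      * exists (cpair c 0). unfold M. rewrite E, cfst_cpair. unfold chk. now rewrite Hc.
    + intros H. split.
      * destruct (H 0) as [y Hy]. apply andb_prop in Hy as [Hy _].
        exact (check_sound _ _ _ _ Hy).
      * intros q Hq. apply check_complete in Hq as [c Hc].
        destruct (H (cpair c q)) as [y Hy]. unfold M in Hy.
        rewrite cfst_cpair, csnd_cpair in Hy. unfold chk in Hy at 2. rewrite Hc in Hy.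
        apply andb_prop in Hy as [_ Hy]. exact (check_sound _ _ _ _ Hy).
Qed.

(** * General facts on rewriting *)

Lemma rsteps_refl R t : rsteps R t t.
Proof. apply rt_refl. Qed.

Lemma rsteps_one R t u : rstep R t u -> rsteps R t u.
Proof. apply rt_step. Qed.

Lemma rsteps_trans R t u v : rsteps R t u -> rsteps R u v -> rsteps R t v.
Proof. apply rt_trans. Qed.

Lemma rsteps_arg R f a t u b :
  rsteps R t u -> rsteps R (Fun f (a ++ t :: b)) (Fun f (a ++ u :: b)).
Proof.
  induction 1 as [t u H|t|t u v _ IH1 _ IH2].
  - apply rsteps_one. now constructor.
  - apply rsteps_refl.
  - exact (rsteps_trans _ _ _ _ IH1 IH2).
Qed.

Lemma rsteps_args R f ts us : Forall2 (rsteps R) ts us -> rsteps R (Fun f ts) (Fun f us).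
Proof.
  intros H. change ts with ([] ++ ts). change us with ([] ++ us). generalize (@nil term).
  induction H as [|t u ts us H _ IH]; intros a; [apply rsteps_refl|].
  apply rsteps_trans with (Fun f (a ++ u :: ts)); [now apply rsteps_arg|].
  specialize (IH (a ++ [u])). now rewrite <- !app_assoc in IH.
Qed.

Lemma rsteps_subst R s s' t :
  (forall x, rsteps R (s x) (s' x)) -> rsteps R (subst s t) (subst s' t).
Proof.
  intros H. induction t as [x|f ts IH] using term_ind_forall; [apply H|].
  cbn [subst]. apply rsteps_args. induction IH; cbn; auto.
Qed.

Lemma Forall2_rsteps_refl R ts : Forall2 (rsteps R) ts ts.
Proof. induction ts; constructor; auto using rsteps_refl. Qed.

Lemma lstep_rsteps R ts us : lstep R ts us -> Forall2 (rsteps R) ts us.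
Proof.
  induction 1 as [t u ts H|t ts us _ IH]; constructor;
    auto using rsteps_refl, rsteps_one, Forall2_rsteps_refl.
Qed.

Lemma lstep_length R ts us : lstep R ts us -> length us = length ts.
Proof. induction 1; cbn; congruence. Qed.

(** Steps in different arguments commute; a peak within one argument is joined by its weak
    confluence. *)
Lemma lstep_join R ts us vs :
  Forall (weakly_confluent_on R) ts -> lstep R ts us -> lstep R ts vs ->
  exists ds, Forall2 (rsteps R) us ds /\ Forall2 (rsteps R) vs ds.
Proof.
  intros W Hu. revert vs W. induction Hu as [t u ts H|t ts us H IH]; intros vs W Hv;
    apply Forall_cons_iff in W as [Wt W]; inversion Hv as [t' v ts' Hv'|t' ts' vs' Hv']; subst.
  - destruct (Wt _ _ H Hv') as [d [H1 H2]]. exists (d :: ts).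
    split; constructor; auto using Forall2_rsteps_refl.
  - exists (u :: vs'). split; constructor;
      auto using rsteps_refl, rsteps_one, lstep_rsteps, Forall2_rsteps_refl.
  - exists (v :: us). split; constructor;
      auto using rsteps_refl, rsteps_one, lstep_rsteps, Forall2_rsteps_refl.
  - destruct (IH _ W Hv') as [ds [H1 H2]]. exists (t :: ds).
    split; constructor; auto using rsteps_refl.
Qed.

Lemma subst_agree s s' t :
  subst s t = subst s' t -> forall x, In x (vars t) -> s x = s' x.
Proof.
  induction t as [y|f ts IH] using term_ind_forall; intros E x Hx.
  - destruct Hx as [->|[]]. exact E.
  - injection E as E. rewrite vars_fun in Hx.
    induction IH as [|t ts Ht _ IHts]; [destruct Hx|].
    injection E as E1 E2. apply in_app_or in Hx as [Hx|Hx]; auto.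
Qed.

Lemma subst_closed s t : vars t = [] -> subst s t = t.
Proof.
  induction t as [y|f ts IH] using term_ind_forall; [discriminate|].
  rewrite vars_fun. intros E. cbn. f_equal. induction IH as [|t ts Ht _ IHts]; [reflexivity|].
  cbn in *. apply app_eq_nil in E as [E1 E2]. now rewrite Ht, IHts.
Qed.

(* Symbols at least 16 are the states of the machine, the others are constructors. *)
Fixpoint constr (t : term) : bool :=
  match t with
  | Var _ => true
  | Fun f ts => (f <? 16) && forallb constr ts
  end.

Lemma constr_subst s t :
  constr (subst s t) = true <->
  constr t = true /\ forall x, In x (vars t) -> constr (s x) = true.
Proof.
  induction t as [y|f ts IH] using term_ind_forall.
  - cbn. firstorder congruence.
  - rewrite vars_fun. cbn [subst constr]. rewrite !andb_true_iff.
    enough (forallb constr (map (subst s) ts) = true <->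
      forallb constr ts = true /\ forall x, In x (flat_map vars ts) -> constr (s x) = true)
      by tauto.
    induction IH as [|t ts Ht _ IHts].
    + cbn. firstorder.
    + cbn. rewrite !andb_true_iff, Ht, IHts. setoid_rewrite in_app_iff. firstorder.
Qed.

Lemma NoDup_app_disjoint {A} (l m : list A) x : NoDup (l ++ m) -> In x l -> ~ In x m.
Proof.
  induction l as [|y l IH]; cbn; intros H Hx; [destruct Hx|].
  inversion H as [|? ? N H']; subst. destruct Hx as [->|Hx]; [|auto].
  intros Hm. apply N, in_or_app. auto.
Qed.

(** * Constructor systems and linear patterns *)

Definition state_rooted (t : term) : Prop := exists f ts, t = Fun f ts /\ 16 <= f.

Section ConstructorSystem.
  Variable R : trs.
  Hypothesis lhs_state : forall l r, In (l, r) (trs_rules R) -> state_rooted l.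

  Lemma rstep_constr_root f ts u :
    f < 16 -> rstep R (Fun f ts) u -> exists us, u = Fun f us /\ lstep R ts us.
  Proof.
    intros Hf H. apply rstep_inv in H as [(l & r & s & Hin & E & _)|(g & ts' & us & E & -> & H)].
    - destruct (lhs_state _ _ Hin) as (g & ls & -> & Hg). injection E as -> _. lia.
    - injection E as <- <-. eauto.
  Qed.

  Lemma constr_normal t u : constr t = true -> ~ rstep R t u.
  Proof.
    revert u. induction t as [x|f ts IH] using term_ind_forall; intros u C H.
    - apply rstep_inv in H as [(l & r & s & Hin & E & _)|(g & ts' & us & E & _)]; [|discriminate].
      destruct (lhs_state _ _ Hin) as (g & ls & -> & Hg). discriminate.
    - cbn [constr] in C. apply andb_prop in C as [Hf C]. apply Nat.ltb_lt in Hf.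
      apply rstep_constr_root in H as (us & -> & H); [|exact Hf].
      clear Hf. induction H as [t u ts H|t ts us _ IHl];
        apply Forall_cons_iff in IH as [Ht IH]; cbn in C; apply andb_prop in C as [Ct C].
      + exact (Ht u Ct H).
      + auto.
  Qed.

  Lemma constr_lnormal ts us : forallb constr ts = true -> ~ lstep R ts us.
  Proof.
    intros C H. induction H as [t u ts H|t ts us _ IH]; cbn in C;
      apply andb_prop in C as [Ct C]; [|auto]. exact (constr_normal t u Ct H).
  Qed.

  (** The hypothesis on [ls] is the conclusion of [pattern_rstep], for use in its induction. As [s']
      changes only variables of the rewritten pattern, linearity leaves the other patterns alone. *)
  Lemma pattern_lstep ls s us :
    Forall (fun l => forall s u, rstep R (subst s l) u ->
       exists s', u = subst s' l /\ (forall x, rsteps R (s x) (s' x)) /\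
         forall x, ~ In x (vars l) -> s' x = s x) ls ->
    NoDup (flat_map vars ls) ->
    lstep R (map (subst s) ls) us ->
    exists s', us = map (subst s') ls /\ (forall x, rsteps R (s x) (s' x)) /\
      forall x, ~ In x (flat_map vars ls) -> s' x = s x.
  Proof.
    intros F. revert us. induction F as [|l ls Hl _ IH]; intros us N H; cbn in *.
    - inversion H.
    - inversion H as [? u ? Hu|? ? vs Hv]; subst.
      + destruct (Hl _ _ Hu) as (s' & -> & S1 & S2). exists s'. repeat split; auto.
        * f_equal. apply map_ext_in. intros t Ht. apply subst_ext. intros x Hx.
          symmetry. apply S2. intros Hx'. eapply NoDup_app_disjoint; [exact N | exact Hx' |].
          apply in_flat_map. eauto.
        * intros x Hx. apply S2. intros Hx'. apply Hx, in_or_app. auto.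
      + destruct (IH _ (NoDup_app_remove_l _ _ N) Hv) as (s' & -> & S1 & S2).
        exists s'. repeat split; auto.
        * f_equal. apply subst_ext. intros x Hx. symmetry. apply S2.
          eapply NoDup_app_disjoint; eauto.
        * intros x Hx. apply S2. intros Hx'. apply Hx, in_or_app. auto.
  Qed.

  (** No left-hand side matches at a constructor, so the step takes place inside the substitution;
      linearity turns it into a change of the substitution. *)
  Lemma pattern_rstep l :
    constr l = true -> NoDup (vars l) ->
    forall s u, rstep R (subst s l) u ->
    exists s', u = subst s' l /\ (forall x, rsteps R (s x) (s' x)) /\
      forall x, ~ In x (vars l) -> s' x = s x.
  Proof.
    induction l as [y|f ts IH] using term_ind_forall; intros C N s u H.
    - exists (fun x => if x =? y then u else s x). cbn. rewrite Nat.eqb_refl.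
      repeat split.
      + intros x. destruct (Nat.eqb_spec x y) as [->|]; auto using rsteps_refl, rsteps_one.
      + intros x Hx. destruct (Nat.eqb_spec x y) as [->|]; [tauto | reflexivity].
    - rewrite vars_fun in *. cbn [constr] in C. apply andb_prop in C as [Hf C].
      apply Nat.ltb_lt in Hf. apply rstep_constr_root in H as (us & -> & H); [|exact Hf].
      destruct (pattern_lstep ts s us) as (s' & -> & S); [|exact N|exact H|].
      2: { exists s'. split; [reflexivity | exact S]. }
      clear H Hf us s. induction IH as [|t ts Ht _ IHts]; constructor; cbn in *;
        apply andb_prop in C as [Ct C].
      + apply Ht; [exact Ct | exact (NoDup_app_remove_r _ _ N)].
      + apply IHts; [exact C | exact (NoDup_app_remove_l _ _ N)].
  Qed.
End ConstructorSystem.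

(** * A computable test for the absence of root overlaps *)

Fixpoint clash (t u : term) : bool :=
  match t, u with
  | Fun f ts, Fun g us =>
      negb (f =? g) ||
      (fix go ts us :=
         match ts, us with
         | [], [] => false
         | t :: ts', u :: us' => clash t u || go ts' us'
         | _, _ => true
         end) ts us
  | _, _ => false
  end.

(** A mismatch of symbols or arities at a common position survives instantiation. The two
    substitutions are independent, as for rules with variables renamed apart. *)
Lemma clash_sound t u s s' : clash t u = true -> subst s t <> subst s' u.
Proof.
  revert u. induction t as [y|f ts IH] using term_ind_forall; intros [z|g us] C E;
    try discriminate.
  injection E as <- E. cbn in C. rewrite Nat.eqb_refl in C. cbn in C.
  revert us C E. induction IH as [|t ts Ht _ IHts]; intros [|u us] C E; try discriminate.
  injection E as E1 E2. apply orb_prop in C as [C|C].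
  - exact (Ht u C E1).
  - exact (IHts us C E2).
Qed.

(** Determinism makes the run to [d] the only one, so accessibility follows backwards along it. This
    lets an infinite run refute halting. *)
Lemma det_halting_acc {A} (step : A -> A -> Prop) (inv : A -> Prop) t d :
  (forall t u v, inv t -> step t u -> step t v -> u = v) ->
  (forall t u, inv t -> step t u -> inv u) ->
  (forall u, ~ step d u) ->
  inv t -> clos_refl_trans A step t d -> Acc (fun u v => step v u) t.
Proof.
  intros Hdet Hinv Hd It H. apply clos_rt_rt1n in H.
  induction H as [d|t u d H _ IH]; constructor; intros v Hv.
  - now apply Hd in Hv.
  - rewrite (Hdet _ _ _ It Hv H). apply IH; eauto.
Qed.

(** * A rewrite system evaluating recursive functions *)

Definition tzero := Fun 0 [].
Definition tsucc t := Fun 1 [t].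
Definition tnil := Fun 2 [].
Definition tcons t u := Fun 3 [t; u].
Definition pgZero := Fun 4 [].
Definition pgSucc := Fun 5 [].
Definition pgProj i := Fun 6 [i].
Definition pgComp f gs := Fun 7 [f; gs].
Definition pgPrec g h := Fun 8 [g; h].
Definition pgMu f := Fun 9 [f].
(** Frames of a continuation stack: [run p xs k] evaluates [p] on [xs], and [ret] hands the value to
    [k]. *)
Definition kHalt := Fun 10 [].
Definition kComp f k := Fun 11 [f; k].
Definition kArg gs xs k := Fun 12 [gs; xs; k].
Definition kCons y k := Fun 13 [y; k].
Definition kPrec h n xs k := Fun 14 [h; n; xs; k].
Definition kMu f n xs k := Fun 15 [f; n; xs; k].
Definition run p xs k := Fun 16 [p; xs; k].
Definition ret y k := Fun 17 [y; k].
Definition start t := Fun 18 [t].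
Definition read t a := Fun 19 [t; a].
Definition done := Fun 20 [].

(** All symbols except zero and successor: no numeral has one of these at its root. *)
Definition junk_sig : signature :=
  [(2, 0); (3, 2); (4, 0); (5, 0); (6, 1); (7, 2); (8, 2); (9, 1); (10, 0); (11, 2);
   (12, 3); (13, 2); (14, 4); (15, 4); (16, 3); (17, 2); (18, 1); (19, 2); (20, 0)].

Definition machine_sig : signature := (0, 0) :: (1, 1) :: junk_sig.

Section Rules.
Local Notation "'$' i" := (Var i) (at level 0, i at level 0).

Definition zero_rule := (run pgZero $0 $1, ret tzero $1).
Definition succ_rule := (run pgSucc (tcons $0 $1) $2, ret (tsucc $0) $2).
Definition proj0_rule := (run (pgProj tzero) (tcons $0 $1) $2, ret $0 $2).
Definition projS_rule :=
  (run (pgProj (tsucc $0)) (tcons $1 $2) $3, run (pgProj $0) $2 $3).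
Definition comp_rule := (run (pgComp $0 $1) $2 $3, run $1 $2 (kComp $0 $3)).
(** A list of programs is itself run: [kArg] holds the programs still to come, [kCons] a value
    already found. *)
Definition nil_rule := (run tnil $0 $1, ret tnil $1).
Definition cons_rule := (run (tcons $0 $1) $2 $3, run $0 $2 (kArg $1 $2 $3)).
Definition arg_rule := (ret $0 (kArg $1 $2 $3), run $1 $2 (kCons $0 $3)).
Definition cons_ret_rule := (ret $0 (kCons $1 $2), ret (tcons $1 $0) $2).
Definition comp_ret_rule := (ret $0 (kComp $1 $2), run $1 $0 $2).
Definition prec0_rule := (run (pgPrec $0 $1) (tcons tzero $2) $3, run $0 $2 $3).
Definition precS_rule :=
  (run (pgPrec $0 $1) (tcons (tsucc $2) $3) $4,
   run (pgPrec $0 $1) (tcons $2 $3) (kPrec $1 $2 $3 $4)).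
Definition prec_ret_rule := (ret $0 (kPrec $1 $2 $3 $4), run $1 (tcons $2 (tcons $0 $3)) $4).
Definition mu_rule := (run (pgMu $0) $1 $2, run $0 (tcons tzero $1) (kMu $0 tzero $1 $2)).
Definition mu_ret0_rule := (ret tzero (kMu $0 $1 $2 $3), ret $1 $3).
Definition mu_retS_rule :=
  (ret (tsucc $0) (kMu $1 $2 $3 $4),
   run $1 (tcons (tsucc $2) $3) (kMu $1 (tsucc $2) $3 $4)).
Definition halt_rule := (ret $0 kHalt, done).
Definition start_done_rule := (start $0, done).
Definition start_read_rule := (start $0, read $0 tzero).
Definition read_succ_rule := (read (tsucc $0) $1, read $0 (tsucc $1)).
(* Since every rule rewrites a state to a state, a term whose root is neither zero nor
   successor keeps this property, so these rules create no unjoinable peaks. *)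
Definition junk_rule (g : nat * nat) :=
  (read (Fun (fst g) (map Var (seq 1 (snd g)))) $0, done).
Definition entry_rule (p n : term) :=
  (read tzero $0, run p (tcons $0 (tcons n tnil)) kHalt).

Definition machine_rules : list (term * term) :=
  [zero_rule; succ_rule; proj0_rule; projS_rule; comp_rule; nil_rule; cons_rule; arg_rule;
   cons_ret_rule; comp_ret_rule; prec0_rule; precS_rule; prec_ret_rule; mu_rule;
   mu_ret0_rule; mu_retS_rule; halt_rule; start_done_rule; start_read_rule; read_succ_rule].

End Rules.

(** The junk rules are kept apart because some have a state symbol below the root, where a step need
    not lie inside the substitution. *)
Definition linear_rules p n := entry_rule p n :: machine_rules.

Definition machine (p n : term) : trs :=
  mkTRS machine_sig (linear_rules p n ++ map junk_rule junk_sig).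

Definition start_pat (t : term) : bool :=
  match t with Fun f _ => f =? 18 | Var _ => false end.

Fixpoint pairwise_clash (ls : list term) : bool :=
  match ls with
  | [] => true
  | l :: ls' =>
      forallb (fun l' => clash l l' || (start_pat l && start_pat l')) ls' &&
      pairwise_clash ls'
  end.

Lemma pairwise_clash_sound (rs : list (term * term)) :
  pairwise_clash (map fst rs) = true ->
  ForallOrdPairs (fun c d => clash (fst c) (fst d) = true \/
    (start_pat (fst c) = true /\ start_pat (fst d) = true)) rs.
Proof.
  induction rs as [|c rs IH]; intros C; constructor; cbn in C; apply andb_prop in C as [C1 C2].
  - apply Forall_forall. intros d Hd. rewrite forallb_forall in C1.
    apply (in_map fst) in Hd. apply C1, orb_prop in Hd as [Hd|Hd]; [now left|].
    right. now apply andb_prop.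
  - auto.
Qed.

Ltac in_rules :=
  cbn [trs_rules machine linear_rules machine_rules app In];
  repeat first [left; reflexivity | right].

(** * Weak ground confluence of the machine *)

Section Machine.
  Variables p n : term.
  Hypothesis p_ground : ground_term machine_sig p.
  Hypothesis n_ground : ground_term machine_sig n.
  Hypothesis p_constr : constr p = true.
  Hypothesis n_constr : constr n = true.

  Notation R := (machine p n).

  (** No right-hand side is rooted in [start], symbol 18, so runs never regain a choice; constructor
      arguments keep states from being nested. *)
  Definition good_rhs (r : term) : Prop :=
    exists g us, r = Fun g us /\ In (g, length us) junk_sig /\ 16 <= g /\ g <> 18 /\
      forallb constr us = true.

  Definition good_rule (l r : term) : Prop :=
    wf_term machine_sig l /\ wf_term machine_sig r /\ incl (vars r) (vars l) /\
    state_rooted l /\ good_rhs r.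

  Ltac wf_tac :=
    cbn; repeat match goal with
      | |- _ /\ _ => split
      | |- True => exact I
      | |- _ \/ _ => repeat first [left; reflexivity | right]
      end.

  Ltac good_rule_tac :=
    unfold good_rule; split; [wf_tac | split; [wf_tac | split;
      [ let x := fresh in intros x; cbn; tauto
      | split; [do 2 eexists; split; [reflexivity | lia]
               | do 2 eexists; split; [reflexivity|]; split; [wf_tac|];
                 split; [lia|]; split; [lia | reflexivity]]]]].

  Lemma rules_good l r : In (l, r) (trs_rules R) -> good_rule l r.
  Proof.
    intros H.
    change (In (l, r) (entry_rule p n :: machine_rules ++ map junk_rule junk_sig)) in H.
    destruct H as [H|H].
    - injection H as <- <-. destruct p_ground as [Wp Vp], n_ground as [Wn Vn].
      unfold good_rule.
      split; [wf_tac|]. split; [cbn; repeat split; auto; wf_tac|].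
      split; [cbn; rewrite Vp, Vn; intros x; cbn; tauto|].
      split; [do 2 eexists; split; [reflexivity | lia]|].
      do 2 eexists. split; [reflexivity|]. split; [wf_tac|]. split; [lia|]. split; [lia|].
      cbn. now rewrite p_constr, n_constr.
    - change (good_rule (fst (l, r)) (snd (l, r))). revert H. generalize (l, r) as c.
      apply (proj1 (Forall_forall (fun c => good_rule (fst c) (snd c)) _)).
      cbn [machine_rules junk_sig map app]. repeat apply Forall_cons; try apply Forall_nil.
      all: cbn [fst snd]; good_rule_tac.
  Qed.

  Lemma rules_state l r : In (l, r) (trs_rules R) -> state_rooted l.
  Proof. intros H. apply (rules_good l r H). Qed.

  Lemma linear_lhs l r :
    In (l, r) (linear_rules p n) ->
    exists f ls, l = Fun f ls /\ forallb constr ls = true /\ NoDup (flat_map vars ls).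
  Proof.
    intros H. apply (in_map fst) in H. cbn [fst] in H. revert l H.
    apply (proj1 (Forall_forall (fun l => exists f ls, l = Fun f ls /\
      forallb constr ls = true /\ NoDup (flat_map vars ls)) _)).
    cbn [linear_rules machine_rules map]. repeat apply Forall_cons; try apply Forall_nil.
    all: do 2 eexists; split; [reflexivity|]; split; [reflexivity|]; cbn;
      repeat apply NoDup_cons; try apply NoDup_nil; cbn; lia.
  Qed.

  Lemma rules_overlap l1 r1 l2 r2 s1 s2 :
    In (l1, r1) (trs_rules R) -> In (l2, r2) (trs_rules R) ->
    subst s1 l1 = subst s2 l2 ->
    (l1, r1) = (l2, r2) \/ (start_pat l1 = true /\ start_pat l2 = true).
  Proof.
    intros H1 H2 E.
    (* The left-hand sides contain neither [p] nor [n], so the test evaluates although both are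
       variables. *)
    assert (F := pairwise_clash_sound (trs_rules R) eq_refl).
    destruct (ForallOrdPairs_In F _ _ H1 H2) as [H|[[H|H]|[H|H]]]; cbn [fst] in H; try tauto.
    - now apply (clash_sound _ _ s1 s2) in H.
    - apply (clash_sound _ _ s2 s1) in H. now symmetry in E.
  Qed.

  Lemma start_rules l r :
    In (l, r) (trs_rules R) -> start_pat l = true ->
    l = start (Var 0) /\ (r = done \/ r = read (Var 0) tzero).
  Proof.
    intros H. set (P := fun c : term * term => start_pat (fst c) = true ->
      fst c = start (Var 0) /\ (snd c = done \/ snd c = read (Var 0) tzero)).
    change (P (l, r)). revert H. apply (proj1 (Forall_forall P _)). unfold P.
    cbn [machine trs_rules linear_rules machine_rules junk_sig map app].
    repeat apply Forall_cons; try apply Forall_nil; intros H; try discriminate H; cbn; auto.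
  Qed.

  Lemma machine_wf : wf_trs R.
  Proof.
    intros l r H. destruct (rules_good l r H) as (W1 & W2 & V & (f & ls & -> & _) & _).
    split; [exact W1|]. split; [exact W2|]. split; [discriminate | exact V].
  Qed.

  Lemma rule_step c l t u :
    In c (trs_rules R) -> t = subst (lsubst l) (fst c) -> u = subst (lsubst l) (snd c) ->
    rstep R t u.
  Proof. destruct c as [a b]. intros H -> ->. now constructor. Qed.

  Definition junk (t : term) : Prop :=
    exists g us, t = Fun g us /\ In (g, length us) junk_sig.

  Lemma junk_read t a : junk t -> rstep R (read t a) done.
  Proof.
    (* Variable 0 is the second argument of [read]; the variables from 1 on are the arguments of
       [g]. *)
    intros (g & us & -> & H). apply (rule_step (junk_rule (g, length us)) (a :: us)).
    - apply in_or_app. right. now apply in_map.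
    - unfold read. cbn. do 3 f_equal. rewrite <- seq_shift, !map_map. clear H.
      change (us = map (fun i => nth i us (Var 0)) (seq 0 (length us))).
      induction us as [|u us IH]; [reflexivity|]. cbn. f_equal.
      rewrite <- seq_shift, map_map. exact IH.
    - reflexivity.
  Qed.

  Lemma good_rhs_junk s r : good_rhs r -> junk (subst s r).
  Proof.
    intros (g & us & -> & H & _). exists g, (map (subst s) us).
    split; [reflexivity|]. now rewrite length_map.
  Qed.

  Lemma junk_step t u : junk t -> rstep R t u -> junk u.
  Proof.
    intros (g & us & -> & H) Hs.
    apply rstep_inv in Hs as [(l & r & s & Hin & E & ->)|(g' & us' & vs & E & -> & Hs)].
    - apply good_rhs_junk. apply (rules_good l r Hin).
    - injection E as <- <-. exists g, vs. split; [reflexivity|].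
      now rewrite (lstep_length _ _ _ Hs).
  Qed.

  (** Under a linear rule the argument step changes only the substitution, and the rule still
      applies. Under a junk rule the first argument of [read] remains junk, so [done] is still
      reached. *)
  Lemma root_arg_join l r s f ts us :
    In (l, r) (trs_rules R) -> subst s l = Fun f ts -> lstep R ts us ->
    exists d, rsteps R (subst s r) d /\ rsteps R (Fun f us) d.
  Proof.
    intros Hin E Hs. change (trs_rules R) with (linear_rules p n ++ map junk_rule junk_sig) in Hin.
    apply in_app_or in Hin as [Hin|Hin].
    - destruct (linear_lhs l r Hin) as (g & ls & -> & C & N). injection E as <- <-.
      destruct (pattern_lstep R ls s us) as (s' & -> & S & _); [|exact N|exact Hs|].
      { rewrite forallb_forall in C. apply Forall_forall. intros t Ht.
        apply pattern_rstep; [exact rules_state | auto|].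
        apply in_split in Ht as (a & b & ->). rewrite flat_map_app in N. cbn in N.
        apply NoDup_app_remove_l in N. now apply NoDup_app_remove_r in N. }
      exists (subst s' r). split; [now apply rsteps_subst|].
      apply rsteps_one, (rs_root R (Fun g ls) r). apply in_or_app. now left.
    - apply in_map_iff in Hin as ([g k] & Ec & Hg). injection Ec as <- <-.
      injection E as <- <-. cbn in Hs. exists done. split; [apply rsteps_refl|].
      apply rsteps_one.
      assert (J : junk (subst s (Fun g (map Var (seq 1 k))))).
      { exists g, (map (subst s) (map Var (seq 1 k))). split; [reflexivity|].
        now rewrite !length_map, length_seq. }
      inversion Hs as [? u ? Hu|? ? vs Hv]; subst.
      + now apply junk_read, (junk_step _ _ J).
      + inversion Hv as [? v ? Hv'|? ? ? Hv']; subst; [|inversion Hv'].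
        now apply junk_read.
  Qed.

  Definition num (k : nat) : term := Nat.iter k tsucc tzero.
  Definition vals (ts : list term) : term := fold_right tcons tnil ts.

  Ltac fire c l :=
    apply rsteps_trans with (subst (lsubst l) (snd c));
    [ apply rsteps_one, (rule_step c l); [in_rules | reflexivity | reflexivity] | cbn ].

  Lemma read_num k a : rsteps R (read (num k) (num a)) (read tzero (num (k + a))).
  Proof.
    revert a. induction k as [|k IH]; intros a; [apply rsteps_refl|].
    fire read_succ_rule [num k; num a]. specialize (IH (S a)).
    now rewrite Nat.add_succ_r in IH.
  Qed.

  (** Peeling off successors ends either at zero, the case of the hypothesis, or at a junk term. *)
  Lemma read_ground t k :
    (forall x, rsteps R (read tzero (num x)) done) ->
    ground_term machine_sig t -> rsteps R (read t (num k)) done.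
  Proof.
    intros H. revert k. induction t as [x|f ts IH] using term_ind_forall; intros k [W V];
      [discriminate|].
    rewrite wf_term_fun in W. rewrite vars_fun in V. destruct W as [[E|[E|J]] W].
    - injection E as <- E. destruct ts; [apply H | discriminate].
    - injection E as <- E. destruct ts as [|t [|]]; try discriminate.
      fire read_succ_rule [t; num k]. cbn in V. rewrite app_nil_r in V.
      apply Forall_cons_iff in IH as [IH _]. apply Forall_cons_iff in W as [W _].
      apply (IH (S k)). now split.
    - apply rsteps_one, junk_read. now exists f, ts.
  Qed.

  Lemma machine_WGC :
    (forall x, rsteps R (read tzero (num x)) done) -> weakly_ground_confluent R.
  Proof.
    intros H t. change (trs_sig R) with machine_sig.
    induction t as [x|f ts IH] using term_ind_forall; intros [W V] t1 t2 H1 H2;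
      [discriminate|].
    assert (G : Forall (ground_term machine_sig) ts).
    { rewrite wf_term_fun in W. rewrite vars_fun in V. destruct W as [_ W].
      clear IH H1 H2. induction W as [|t ts Wt _ IHt]; constructor; cbn in V;
        apply app_eq_nil in V as [V1 V2]; [now split | auto]. }
    apply rstep_inv in H1 as [(l1 & r1 & s1 & In1 & E1 & ->)|(f1 & ts1 & us1 & E1 & -> & S1)];
    apply rstep_inv in H2 as [(l2 & r2 & s2 & In2 & E2 & ->)|(f2 & ts2 & us2 & E2 & -> & S2)].
    - destruct (rules_overlap _ _ _ _ s1 s2 In1 In2) as [E|[P1 P2]]; [congruence| |].
      + injection E as -> ->. exists (subst s2 r2).
        replace (subst s1 r2) with (subst s2 r2); [split; apply rsteps_refl|].
        (* The substitutions agree on the variables of the left-hand side, which include those of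
           the right-hand side. *)
        apply subst_ext. intros x Hx. symmetry. apply (subst_agree _ _ l2); [congruence|].
        destruct (rules_good _ _ In2) as (_ & _ & Vr & _). auto.
      + destruct (start_rules _ _ In1 P1) as [-> R1].
        destruct (start_rules _ _ In2 P2) as [-> R2].
        cbn in E1, E2. injection E1 as -> E1. injection E2 as E2. rewrite E1 in E2.
        injection E2 as E2. subst ts. apply Forall_cons_iff in G as [G _].
        (* Every side of a [start] peak reaches [done]; [tzero] is [num 0], the initial counter. *)
        assert (B : rsteps R (read (s1 0) tzero) done) by now apply (read_ground _ 0).
        exists done. split.
        * destruct R1 as [->| ->]; [apply rsteps_refl | exact B].
        * destruct R2 as [->| ->]; [apply rsteps_refl|]. cbn. rewrite <- E2. exact B.
    - injection E2 as <- <-.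
      exact (root_arg_join l1 r1 s1 f ts us2 In1 (eq_sym E1) S2).
    - injection E1 as <- <-.
      destruct (root_arg_join l2 r2 s2 f ts us1 In2 (eq_sym E2) S1) as [d [D1 D2]]. eauto.
    - injection E1 as <- <-. injection E2 as <- <-.
      assert (C : Forall (weakly_confluent_on R) ts).
      { rewrite Forall_forall in *. auto. }
      destruct (lstep_join R ts us1 us2 C S1 S2) as [ds [D1 D2]].
      exists (Fun f ds). split; now apply rsteps_args.
  Qed.

  (** * Determinism of runs *)

  Definition config (t : term) : Prop :=
    exists f ts, t = Fun f ts /\ f <> 18 /\ forallb constr ts = true.

  (** The arguments are constructor terms, hence normal, so only the root is rewritten; a root other
      than [start] excludes the overlapping rules. *)
  Lemma config_rstep t u :
    config t -> rstep R t u ->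
    exists l r s, In (l, r) (trs_rules R) /\ start_pat l = false /\
      t = subst s l /\ u = subst s r.
  Proof.
    intros (f & ts & -> & Hf & C) H.
    apply rstep_inv in H as [(l & r & s & Hin & E & ->)|(g & ts' & us & E & -> & H)].
    - exists l, r, s. repeat split; auto.
      destruct (rules_state l r Hin) as (g & ls & -> & _). injection E as <- _.
      now apply Nat.eqb_neq.
    - injection E as <- <-. now apply (constr_lnormal R rules_state) in H.
  Qed.

  Lemma config_det t u v : config t -> rstep R t u -> rstep R t v -> u = v.
  Proof.
    intros C Hu Hv. apply (config_rstep _ _ C) in Hu as (l1 & r1 & s1 & In1 & P1 & E1 & ->).
    apply (config_rstep _ _ C) in Hv as (l2 & r2 & s2 & In2 & P2 & E2 & ->).
    destruct (rules_overlap _ _ _ _ s1 s2 In1 In2) as [E|[P _]]; [congruence| |congruence].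
    injection E as -> ->. apply subst_ext. intros x Hx.
    apply (subst_agree _ _ l2); [congruence|]. destruct (rules_good _ _ In2) as (_ & _ & Vr & _). auto.
  Qed.

  Lemma config_closed t u : config t -> rstep R t u -> config u.
  Proof.
    intros C H. pose proof C as (f & ts & Et & _ & Ct).
    apply (config_rstep _ _ C) in H as (l & r & s & Hin & _ & E & ->).
    destruct (rules_good l r Hin) as (_ & _ & V & (g & ls & -> & _) & (h & rs & -> & _ & _ & Nh & Cr)).
    rewrite Et in E. injection E as <- ->. exists h, (map (subst s) rs).
    split; [reflexivity|]. split; [exact Nh|].
    rewrite forallb_forall in *. intros t' Ht'. apply in_map_iff in Ht' as (r' & <- & Hr').
    apply constr_subst. split; [auto|]. intros x Hx.
    assert (Hl : In x (vars (Fun f ls))).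
    { apply V. rewrite vars_fun. apply in_flat_map. eauto. }
    rewrite vars_fun in Hl. apply in_flat_map in Hl as (l' & Hl' & Hx').
    specialize (Ct (subst s l') (in_map _ _ _ Hl')). apply constr_subst in Ct as [_ Ct]. auto.
  Qed.

  Lemma done_normal u : ~ rstep R done u.
  Proof.
    intros H. assert (C : config done) by (exists 20, []; repeat split; lia).
    apply (config_rstep _ _ C) in H as (l & r & s & Hin & _ & E & _).
    assert (N : clash l done = true).
    { apply (in_map fst) in Hin. cbn [fst] in Hin. clear E. revert l Hin.
      apply (proj1 (Forall_forall (fun l => clash l done = true) _)).
      cbn [machine trs_rules linear_rules machine_rules junk_sig map app].
      repeat apply Forall_cons; try apply Forall_nil; reflexivity. }
    apply (clash_sound _ _ s s) in N. now symmetry in E.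
  Qed.

  (** * Compilation and simulation of recursive functions *)

  Fixpoint program (q : rf) : term :=
    match q with
    | RZero => pgZero
    | RSucc => pgSucc
    | RProj i => pgProj (num i)
    | RComp f gs => pgComp (program f) (vals (map program gs))
    | RPrec g h => pgPrec (program g) (program h)
    | RMu f => pgMu (program f)
    end.

  Notation nums xs := (vals (map num xs)).

  Lemma run_proj i xs k :
    i < length xs -> rsteps R (run (pgProj (num i)) (nums xs) k) (ret (num (nth i xs 0)) k).
  Proof.
    revert i. induction xs as [|x xs IH]; intros [|i] L; cbn in L; try lia.
    - fire proj0_rule [num x; nums xs; k]. apply rsteps_refl.
    - fire projS_rule [num i; num x; nums xs; k]. apply IH. lia.
  Qed.

  (** Recursion on the derivation itself also reaches the evaluations that [ev_mu] hides under an
      existential quantifier. *)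
  Fixpoint run_eval q xs y (H : eval q xs y) {struct H} :
    forall k, rsteps R (run (program q) (nums xs) k) (ret (num y) k)
  with run_evals qs xs ys (H : evals qs xs ys) {struct H} :
    forall k, rsteps R (run (vals (map program qs)) (nums xs) k) (ret (nums ys) k).
  Proof.
    - destruct H as [xs|x xs|i xs L|f gs xs ys y Hs Hf|g h xs y Hg|g h m xs r y Hr Hh|f xs m Hf Hlt];
        intros k; cbn [program map].
      + fire zero_rule [nums xs; k]. apply rsteps_refl.
      + fire succ_rule [num x; nums xs; k]. apply rsteps_refl.
      + now apply run_proj.
      + fire comp_rule [program f; vals (map program gs); nums xs; k].
        eapply rsteps_trans; [exact (run_evals _ _ _ Hs _)|].
        fire comp_ret_rule [nums ys; program f; k]. exact (run_eval _ _ _ Hf _).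
      + fire prec0_rule [program g; program h; nums xs; k]. exact (run_eval _ _ _ Hg _).
      + fire precS_rule [program g; program h; num m; nums xs; k].
        eapply rsteps_trans; [exact (run_eval _ _ _ Hr _)|].
        fire prec_ret_rule [num r; program h; num m; nums xs; k].
        exact (run_eval _ _ _ Hh _).
      + fire mu_rule [program f; nums xs; k].
        (* The loop arrives at each candidate [j] up to [m], since all smaller candidates give
           positive values. *)
        assert (L : forall j, j <= m -> rsteps R
          (run (program f) (nums (0 :: xs)) (kMu (program f) tzero (nums xs) k))
          (run (program f) (nums (j :: xs)) (kMu (program f) (num j) (nums xs) k))).
        { intros j. induction j as [|j IHj]; intros Hj; [apply rsteps_refl|].
          eapply rsteps_trans; [apply IHj; lia|].
          destruct (Hlt j Hj) as [v Hv].
          eapply rsteps_trans; [exact (run_eval _ _ _ Hv _)|].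
          fire mu_retS_rule [num v; program f; num j; nums xs; k]. apply rsteps_refl. }
        eapply rsteps_trans; [exact (L m (le_n m))|].
        eapply rsteps_trans; [exact (run_eval _ _ _ Hf _)|].
        fire mu_ret0_rule [program f; num m; nums xs; k]. apply rsteps_refl.
    - destruct H as [xs|g gs xs y ys Hg Hs]; intros k; cbn [map].
      + fire nil_rule [nums xs; k]. apply rsteps_refl.
      + fire cons_rule [program g; vals (map program gs); nums xs; k].
        eapply rsteps_trans; [exact (run_eval _ _ _ Hg _)|].
        fire arg_rule [num y; vals (map program gs); nums xs; k].
        eapply rsteps_trans; [exact (run_evals _ _ _ Hs _)|].
        fire cons_ret_rule [nums ys; num y; k]. apply rsteps_refl.
  Qed.
End Machine.

Lemma num_ground k : ground_term machine_sig (num k).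
Proof.
  induction k as [|k [W V]]; cbn.
  - repeat split. now left.
  - repeat split; [right; now left | exact W | cbn; rewrite app_nil_r; exact V].
Qed.

Lemma num_constr k : constr (num k) = true.
Proof. induction k as [|k IH]; [reflexivity|]. cbn. now rewrite andb_true_r. Qed.

Section RfInd.
  Variable P : rf -> Prop.
  Hypothesis HZ : P RZero.
  Hypothesis HS : P RSucc.
  Hypothesis HP : forall i, P (RProj i).
  Hypothesis HC : forall f gs, P f -> Forall P gs -> P (RComp f gs).
  Hypothesis HR : forall g h, P g -> P h -> P (RPrec g h).
  Hypothesis HM : forall f, P f -> P (RMu f).

  Fixpoint rf_ind_forall (q : rf) : P q :=
    match q with
    | RZero => HZ
    | RSucc => HS
    | RProj i => HP i
    | RComp f gs =>
        HC f gs (rf_ind_forall f)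
          ((fix go (l : list rf) : Forall P l :=
              match l with
              | [] => Forall_nil P
              | g :: l' => Forall_cons g (rf_ind_forall g) (go l')
              end) gs)
    | RPrec g h => HR g h (rf_ind_forall g) (rf_ind_forall h)
    | RMu f => HM f (rf_ind_forall f)
    end.
End RfInd.

Lemma ground_fun f ts :
  In (f, length ts) machine_sig -> Forall (ground_term machine_sig) ts ->
  ground_term machine_sig (Fun f ts).
Proof.
  intros H G. split.
  - apply wf_term_fun. split; [exact H|]. revert G. apply Forall_impl. now intros t [W _].
  - rewrite vars_fun. clear H. induction G as [|t ts [_ V] _ IH]; [reflexivity|].
    cbn. now rewrite V, IH.
Qed.

Lemma program_ground q : ground_term machine_sig (program q).
Proof.
  assert (L : forall ts, Forall (ground_term machine_sig) ts ->
            ground_term machine_sig (vals ts)).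
  { induction 1; apply ground_fun; cbn; tauto || auto. }
  induction q using rf_ind_forall; apply ground_fun; cbn; try tauto; auto using num_ground.
  do 2 (constructor; auto). apply L. now apply Forall_map.
Qed.

Lemma program_constr q : constr (program q) = true.
Proof.
  assert (L : forall ts, Forall (fun t => constr t = true) ts -> constr (vals ts) = true).
  { induction 1 as [|t ts Ht _ IH]; [reflexivity|].
    change (constr (tcons t (vals ts)) = true). cbn -[vals]. now rewrite Ht, IH. }
  induction q as [| |i|f gs Hf Hgs|g h Hg Hh|f Hf] using rf_ind_forall; cbn -[vals];
    rewrite ?num_constr, ?Hf, ?Hg, ?Hh; try reflexivity.
  rewrite L; [reflexivity|]. now apply Forall_map.
Qed.

(** * Search by minimization *)

Definition search_machine (q : rf) (n : nat) : trs := machine (program (RMu q)) (num n).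

Section Search.
  Variable q : rf.
  Variable n : nat.

  Notation R := (search_machine q n).
  Let pg := program_ground (RMu q).
  Let pc := program_constr (RMu q).
  Let ng := num_ground n.
  Let nc := num_constr n.

  Lemma read_entry x :
    rsteps R (read tzero (num x))
      (run (program (RMu q)) (vals (map num [x; n])) kHalt).
  Proof.
    apply rsteps_one, (rule_step _ _ (entry_rule (program (RMu q)) (num n)) [num x]).
    - now left.
    - reflexivity.
    - cbn [entry_rule fst snd subst run tcons tnil kHalt map]. unfold run, tcons.
      cbn [subst map]. rewrite !subst_closed by (apply pg || apply ng). reflexivity.
  Qed.

  Lemma search_halts x y : eval (RMu q) [x; n] y -> rsteps R (read tzero (num x)) done.
  Proof.
    intros H. eapply rsteps_trans; [apply read_entry|].
    eapply rsteps_trans; [exact (run_eval _ _ _ _ _ H _)|].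
    apply rsteps_one, (rule_step _ _ halt_rule [num y]); [|reflexivity|reflexivity].
    unfold search_machine; in_rules.
  Qed.

  (** The final step makes the reduction nonempty, as needed for a strict descent in the converse
      relation. *)
  Lemma rsteps_rstep_flip t u v :
    rsteps R t u -> rstep R u v -> clos_trans term (fun a b => rstep R b a) v t.
  Proof.
    intros H Hv. apply clos_rt_rt1n in H. induction H as [t|t w u Hw _ IH].
    - now apply t_step.
    - eapply t_trans; [exact (IH Hv) | now apply t_step].
  Qed.

  Lemma search_diverges x :
    (forall y, exists k, eval q [y; x; n] (S k)) ->
    ~ rsteps R (read (num x) tzero) done.
  Proof.
    intros Hq H.
    apply (det_halting_acc (rstep R) config) in H.
    (* [C y] is the configuration in which the test of candidate [y] begins. *)
    - set (C := fun y => run (program q) (vals (map num [y; x; n]))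
                  (kMu (program q) (num y) (vals (map num [x; n])) kHalt)).
      assert (H0 : rsteps R (read (num x) tzero) (C 0)).
      { eapply rsteps_trans; [exact (read_num _ _ x 0)|]. rewrite Nat.add_0_r.
        eapply rsteps_trans; [apply read_entry|].
        apply rsteps_one, (rule_step _ _ mu_rule [program q; vals (map num [x; n]); kHalt]);
          [|reflexivity|reflexivity].
        unfold search_machine; in_rules. }
      assert (HS : forall y, clos_trans term (fun a b => rstep R b a) (C (S y)) (C y)).
      { intros y. destruct (Hq y) as [k Hk].
        eapply rsteps_rstep_flip; [exact (run_eval _ _ _ _ _ Hk _)|].
        apply (rule_step _ _ mu_retS_rule
          [num k; program q; num y; vals (map num [x; n]); kHalt]); [|reflexivity|reflexivity].
        unfold search_machine; in_rules. }
      assert (A : Acc (clos_trans term (fun a b => rstep R b a)) (C 0)).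
      { apply Acc_clos_trans. clear HS. apply clos_rt_rt1n in H0.
        induction H0 as [t|t u v Hu _ IH]; [exact H|]. apply IH, H, Hu. }
      (* The configurations [C y], [C (S y)], ... descend forever, so none is accessible. *)
      revert A. generalize 0 as y. intros y A. remember (C y) as t eqn:E. revert y E.
      induction A as [t _ IH]. intros y ->. exact (IH _ (HS y) _ eq_refl).
    - intros t u v. now apply config_det.
    - intros t u. now apply config_closed.
    - intros u. now apply done_normal.
    - do 2 eexists. repeat split; [discriminate|]. cbn. now rewrite num_constr.
  Qed.

  Lemma search_machine_WGC (Q : nat -> nat -> Prop) :
    (forall y x, Q y x -> eval q [y; x; n] 0) ->
    (forall y x, ~ Q y x -> exists k, eval q [y; x; n] (S k)) ->
    weakly_ground_confluent R <-> forall x, exists y, Q y x.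
  Proof.
    intros T F. split.
    - intros W x. apply NNPP. intros N.
      assert (N' : forall y, exists k, eval q [y; x; n] (S k)) by eauto.
      (* One side of this peak is the normal form [done], so joinability makes the other side reach
         [done]. *)
      destruct (W (start (num x))) with (t1 := done) (t2 := read (num x) tzero)
        as [d [D1 D2]].
      + apply ground_fun; [cbn; tauto|]. auto using num_ground.
      + apply (rule_step _ _ start_done_rule [num x]); [|reflexivity|reflexivity].
        unfold search_machine; in_rules.
      + apply (rule_step _ _ start_read_rule [num x]); [|reflexivity|reflexivity].
        unfold search_machine; in_rules.
      + apply clos_rt_rt1n in D1. inversion D1 as [|u v Hu]; subst.
        * exact (search_diverges x N' D2).
        * eapply done_normal; [| | | |exact Hu]; auto.
    - intros H. apply machine_WGC; auto. intros x.
      enough (exists y, eval (RMu q) [x; n] y) as [y Hy] by exact (search_halts x y Hy).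
      destruct (H x) as [y Hy]. induction y as [y IH] using lt_wf_ind.
      (* [RMu] requires positive values below its result, so the induction descends to the least
         witness. *)
      destruct (classic (exists m, m < y /\ Q m x)) as [[m [L Hm]]|N].
      + exact (IH m L Hm).
      + exists y. constructor; [exact (T y x Hy)|]. intros m L. apply F. eauto.
  Qed.
End Search.

(** * Computability of the reduction and hardness *)

Lemma comp_code_fun k f T :
  comp k (fun xs => codes (T xs)) -> comp k (fun xs => code_term (Fun f (T xs))).
Proof.
  intros H. apply (comp_cpair k (fun _ => 1) (fun xs => cpair f (codes (T xs))));
    [apply comp_const|].
  apply (comp_cpair k (fun _ => f)); [apply comp_const | exact H].
Qed.

Lemma comp_codes_cons k t T :
  comp k (fun xs => code_term (t xs)) -> comp k (fun xs => codes (T xs)) ->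
  comp k (fun xs => codes (t xs :: T xs)).
Proof. intros Ht HT. exact (comp_succ k _ (comp_cpair k _ _ Ht HT)). Qed.

Lemma comp_code_num k F : comp k F -> comp k (fun xs => code_term (num (F xs))).
Proof.
  intros HF. eapply comp_ext.
  - apply (comp_rec k (fun _ => code_term tzero)
      (* The first 1 marks an application, the second is the successor symbol, and [S (cpair _ 0)]
         codes a singleton list. *)
      (fun ys => cpair 1 (cpair 1 (S (cpair (nth 1 ys 0) 0)))) F); [apply comp_const| |exact HF].
    repeat first [apply comp_nth; lia | apply comp_const | apply comp_cpair | apply comp_succ].
  - intros xs _. cbn beta. induction (F xs) as [|m IH]; [reflexivity|].
    cbn [nat_rect]. rewrite IH. reflexivity.
Qed.

Lemma search_machine_computable q : computable (fun n => code_trs (search_machine q n)).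
Proof.
  assert (H : comp 1 (fun xs => code_trs (search_machine q (nth 0 xs 0)))).
  { apply (comp_cpair 1 (fun _ => code_sig machine_sig)
      (fun xs => code_rules (trs_rules (search_machine q (nth 0 xs 0)))));
      [apply comp_const|].
    (* Only the entry rule depends on the input, and it heads the rule list; the code of the
       remaining rules is a constant. *)
    apply (comp_succ 1 (fun xs => cpair
      (cpair (code_term (read tzero (Var 0)))
         (code_term (run (program (RMu q)) (tcons (Var 0) (tcons (num (nth 0 xs 0)) tnil)) kHalt)))
      (code_rules (machine_rules ++ map junk_rule junk_sig)))).
    apply comp_cpair; [|apply comp_const]. apply comp_cpair; [apply comp_const|].
    unfold run, tcons.
    repeat first [apply comp_const | apply comp_code_num, comp_nth; lia
                 | apply comp_code_fun | apply comp_codes_cons]. }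
  destruct H as [p Hp]. exists p. intros n. exact (Hp [n] eq_refl).
Qed.

Lemma WGC_codes_hard A : Pi0 2 A -> m_reducible A WGC_codes.
Proof.
  intros [Q1 [[Q0 [[p Hp] H0]] H1]].
  (* Minimization looks for a zero while [p] answers 1 for truth, so the answer is negated: the
     recursion sends 0 to 1 and successors to 0. *)
  set (q := RComp (RPrec (RComp RSucc [RZero]) RZero) [p]).
  exists (fun n => code_trs (search_machine q n)).
  split; [apply search_machine_computable|]. intros n.
  assert (one : eval (RComp RSucc [RZero]) [] 1).
  { apply (ev_comp _ _ _ [0]); repeat constructor. }
  assert (E : A n <-> weakly_ground_confluent (search_machine q n)).
  { rewrite (H1 [n] eq_refl), (search_machine_WGC q n (fun y x => Q0 [y; x; n])).
    - split; intros H x; now apply (H0 [x; n] eq_refl).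
    - intros y x H. apply (ev_comp _ _ _ [1]).
      + constructor; [exact (proj1 (Hp [y; x; n] eq_refl) H) | constructor].
      + apply (ev_precS _ _ _ _ 1); [now constructor | constructor].
    - intros y x H. exists 0. apply (ev_comp _ _ _ [0]).
      + constructor; [exact (proj2 (Hp [y; x; n] eq_refl) H) | constructor].
      + now constructor. }
  rewrite E. split.
  - intros W. exists (search_machine q n). split; [|exact (conj eq_refl W)].
    apply machine_wf; auto using program_ground, program_constr, num_ground, num_constr.
  (* Injectivity of the coding identifies the TRS behind the code with the machine. *)
  - intros (R & _ & Ec & W). apply code_trs_inj in Ec. now subst R.
Qed.

Theorem theorem6 : Pi0_complete 2 WGC_codes.
Proof. split; [exact WGC_codes_Pi2 | exact WGC_codes_hard]. Qed.
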